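(* Let $A\in\mathbb{R}_{\max}^{d\times d}$ be irreducible. Let $r$ be the (tropical) factor rank of $A$, $\gamma$ the cyclicity of $\mathcal{G}(A)$, and $\hat g$ the maximal girth of the strongly connected components of $\mathcal{G}^c(A)$. Then the following upper bounds hold: (i) $T_{1,\mathrm{N}}(A)\le \mathrm{Wi}(r)+1$; (ii) $T_{1,\mathrm{N}}(A)\le \hat g\,(r-2)+r+1$; (iii) $T_{1,\mathrm{N}}(A)\le \gamma\,\mathrm{Wi}\left(\left\lfloor\frac{r}{\gamma}\right\rfloor\right)+(r\operatorname{rem}\gamma)+1$; (iv) $T_{1,\mathrm{N}}(A)\le \hat g\left(\left\lfloor\frac{r}{\gamma}\right\rfloor-2\right)+r+1$. Moreover, bounds (i) and (ii) also hold for reducible matrices $A\in\mathbb{R}_{\max}^{d\times d}$ (with $\lambda(A)\neq-\infty$).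
   Context: Max-plus algebra: $\mathbb{R}_{\max}=\mathbb{R}\cup\{-\infty\}$ with $a\oplus b=\max(a,b)$ and $a\otimes b=a+b$, extended to matrices by $(A\oplus B)_{ij}=a_{ij}\oplus b_{ij}$ and $(AB)_{ij}=(A\otimes B)_{ij}=\bigoplus_k a_{ik}\otimes b_{kj}$. $A^t$ is the $t$-th max-plus power, $A^0=I$ (entries $0$ on the diagonal, $-\infty$ elsewhere); $\lambda^{\otimes t}=t\lambda$ for a scalar, and $\mu\otimes A$ adds $\mu$ to every entry. Factor rank: the (tropical) factor rank of $A\in\mathbb{R}_{\max}^{n\times m}$ is the smallest $r\in\mathbb{N}$ such that $A=U\otimes L$ for some $U\in\mathbb{R}_{\max}^{n\times r}$ and $L\in\mathbb{R}_{\max}^{r\times m}$. Graphs: $\mathcal{G}(A)$ is the weighted digraph with nodes $1,\dots,d$ and an arc $(i,j)$ of weight $a_{ij}$ whenever $a_{ij}\ne-\infty$. A cycle is a closed walk with at least one arc and no repeated node other than its coinciding ends; length is the number of arcs. $A$ is irreducible if $\mathcal{G}(A)$ is strongly connected (otherwise reducible); the $1\times1$ matrix $(-\infty)$ is excluded, so that the maximum cycle mean $\lambda(A)$ (the maximum over all cycles of $\mathcal{G}(A)$ of weight divided by length; $-\infty$ if there are no cycles) is finite. The critical graph $\mathcal{G}^c(A)$ consists of all nodes and arcs of cycles with mean weight $\lambda(A)$; it is a disjoint union of strongly connected components with no arcs between them. The girth of a strongly connected digraph is the smallest length of a cycle in it. The cyclicity of a strongly connected digraph is the gcd of the lengths of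 its cycles; the cyclicity of a disjoint union of strongly connected components is the lcm of the cyclicities of the components. CSR terms: let $\sigma$ be the cyclicity of $\mathcal{G}^c(A)$ and $M=\left(((-\lambda(A))\otimes A)^{\sigma}\right)^*$, where $N^*=\bigoplus_{i\ge0}N^i$. Define $d\times d$ matrices $C,S,R$ by: $c_{ij}=m_{ij}$ if $j$ is a node of $\mathcal{G}^c(A)$ and $-\infty$ otherwise; $r_{ij}=m_{ij}$ if $i$ is a node of $\mathcal{G}^c(A)$ and $-\infty$ otherwise; $s_{ij}=a_{ij}-\lambda(A)$ if $(i,j)$ is an arc of $\mathcal{G}^c(A)$ and $-\infty$ otherwise. $CS^tR$ is the max-plus product (with $S^0=I$). Nachtigall scheme: $B_{\mathrm{N}}[A]$ is the matrix with entries $-\infty$ at $(i,j)$ if $i$ or $j$ is a node of $\mathcal{G}^c(A)$, and $a_{ij}$ otherwise. $T_{1,\mathrm{N}}(A)$ is the smallest nonnegative integer $T$ such that $A^t=\left(\lambda(A)^{\otimes t}\otimes CS^tR\right)\oplus (B_{\mathrm{N}}[A])^t$ for all $t\ge T$. $\mathrm{Wi}(n)=(n-1)^2+1$ if $n>1$ and $\mathrm{Wi}(1)=0$. $r\operatorname{rem}\gamma$ is the remainder of the Euclidean division of $r$ by $\gamma$. *)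

(* Defs.v *)
From HB Require Import structures.
From mathcomp Require Import all_boot all_order all_algebra.
From mathcomp Require Import boolp classical_sets reals.

Set Implicit Arguments.
Unset Strict Implicit.
Unset Printing Implicit Defensive.

Import Order.TTheory GRing.Theory Num.Theory.
Local Open Scope ring_scope.

(* [None] stands for -oo.  In the semiring structure below, [0] is -oo, [1] is
   the real number 0, [x + y] is the maximum and [x * y] the sum of reals, so
   that MathComp's matrix operations are the max-plus ones. *)
Definition Rmax (R : realType) : Type := option R.

Section RmaxSemiRing.
Variable R : realType.
Implicit Types x y z : Rmax R.

HB.instance Definition _ := Choice.copy (Rmax R) (option R).

Definition rmax_add x y : Rmax R :=
  match x, y with
  | Some a, Some b => Some (Num.max a b)
  | Some _, None => x
  | None, _ => y
  end.

Definition rmax_mul x y : Rmax R :=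
  match x, y with
  | Some a, Some b => Some (a + b)
  | _, _ => None
  end.

Fact rmax_addA : associative rmax_add.
Proof. by move=> [a|] [b|] [c|] //=; rewrite maxA. Qed.

Fact rmax_addC : commutative rmax_add.
Proof. by move=> [a|] [b|] //=; rewrite maxC. Qed.

Fact rmax_add0 : left_id None rmax_add.
Proof. by case. Qed.

Fact rmax_mulA : associative rmax_mul.
Proof. by move=> [a|] [b|] [c|] //=; rewrite addrA. Qed.

Fact rmax_mulC : commutative rmax_mul.
Proof. by move=> [a|] [b|] //=; rewrite addrC. Qed.

Fact rmax_mul1 : left_id (Some 0) rmax_mul.
Proof. by case=> [a|] //=; rewrite add0r. Qed.

Fact rmax_mulDl : left_distributive rmax_mul rmax_add.
Proof. by move=> [a|] [b|] [c|] //=; rewrite addr_maxl. Qed.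

Fact rmax_mul0 : left_zero None rmax_mul.
Proof. by []. Qed.

HB.instance Definition _ :=
  GRing.isNmodule.Build (Rmax R) rmax_addA rmax_addC rmax_add0.

HB.instance Definition _ :=
  GRing.Nmodule_isComNzSemiRing.Build (Rmax R)
    rmax_mulA rmax_mulC rmax_mul1 rmax_mulDl rmax_mul0 isT.

(* The max-plus inverse -x. *)
Definition rmax_inv x : Rmax R := omap (fun a => - a) x.

(* Supremum in Rmax.  As [sup] is a junk value on unbounded sets of reals, this
   is the supremum only for sets bounded above by a real number. *)
Definition rmax_sup (X : set (Rmax R)) : Rmax R :=
  if `[< exists a : R, X (Some a) >] then Some (sup [set a : R | X (Some a)])
  else None.

End RmaxSemiRing.

Section FactorRank.
Variables (R : realType) (n m : nat) (A : 'M[Rmax R]_(n, m)).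

Definition factorizes (r : nat) : Prop :=
  exists (U : 'M[Rmax R]_(n, r)) (L : 'M[Rmax R]_(r, m)), A = U *m L.

Fact factorizes_ex : exists r, `[< factorizes r >].
Proof. by exists m; apply/asboolP; exists A, 1%:M; rewrite mulmx1. Qed.

Definition factor_rank : nat := ex_minn factorizes_ex.

End FactorRank.

Section Digraphs.
Variables (T : finType) (e : rel T).

(* The cycle visiting the nodes of [c] in turn and closing up; its length
   (number of arcs) is [size c]. *)
Definition is_cycle (c : seq T) : bool := (c != [::]) && ucycleb e c.

Definition strongly_connected : bool := [forall i, forall j, connect e i j].

Definition scc (i : T) : {set T} := [set j | connect e i j && connect e j i].

(* [k] is the length of a cycle of [e] with all its nodes in [B]. *)
Definition cycle_length_in (B : {set T}) (k : nat) : bool :=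
  [exists c : k.-tuple T, is_cycle c && all (fun i => i \in B) c].

(* Cycles have no repeated node, so their lengths are at most #|T|; the default
   value #|T| of the minimum only matters when there is no cycle in [B]. *)
Definition girth_in (B : {set T}) : nat :=
  \big[minn/#|T|]_(k < #|T|.+1 | cycle_length_in B k) k.

Definition cyclicity_in (B : {set T}) : nat :=
  \big[gcdn/0]_(k < #|T|.+1 | cycle_length_in B k) k.

End Digraphs.

Section MaxPlusMatrix.
Variables (R : realType) (d : nat) (A : 'M[Rmax R]_d).

Definition arc : rel 'I_d := fun i j => A i j != 0.

Definition irreducible : Prop :=
  strongly_connected arc /\ ~ (d = 1%N /\ forall i j, A i j = 0).

Definition reducible : Prop := ~~ strongly_connected arc.

(* The product is the weight of the cycle [c]; its real value is divided by the
   length. *)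
Definition cycle_mean (c : seq 'I_d) : Rmax R :=
  omap (fun w => w / (size c)%:R) (\prod_(i <- c) A i (next c i)).

(* Maximum over all cycles (of length k <= d, as no node is repeated). *)
Definition max_cycle_mean : Rmax R :=
  \sum_(k < d.+1) \sum_(c : k.-tuple 'I_d | is_cycle arc c) cycle_mean c.

Definition critical_cycle (c : seq 'I_d) : bool :=
  is_cycle arc c && (cycle_mean c == max_cycle_mean).

Definition critical_node (i : 'I_d) : bool :=
  `[< exists c, critical_cycle c /\ i \in c >].

Definition critical_arc : rel 'I_d := fun i j =>
  `[< exists c, [/\ critical_cycle c, i \in c & j = next c i] >].

Definition critical_components : {set {set 'I_d}} :=
  [set scc critical_arc i | i in critical_node].

Definition critical_cyclicity : nat :=
  \big[lcmn/1]_(B in critical_components) cyclicity_in critical_arc B.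

Definition max_critical_girth : nat :=
  \max_(B in critical_components) girth_in critical_arc B.

(* G(A) is meant to be strongly connected here, i.e., a single component. *)
Definition graph_cyclicity : nat := cyclicity_in arc [set: 'I_d].

Definition kleene_star (N : 'M[Rmax R]_d) : 'M[Rmax R]_d :=
  \matrix_(i, j) rmax_sup [set x | exists k : nat, x = (N ^+ k) i j].

(* All cycles of the matrix under the star have nonpositive weight, so its
   powers are bounded above and the entrywise suprema are genuine. *)
Definition csr_M : 'M[Rmax R]_d :=
  kleene_star ((rmax_inv max_cycle_mean *: A) ^+ critical_cyclicity).

Definition csr_C : 'M[Rmax R]_d :=
  \matrix_(i, j) if critical_node j then csr_M i j else 0.

Definition csr_R : 'M[Rmax R]_d :=
  \matrix_(i, j) if critical_node i then csr_M i j else 0.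

Definition csr_S : 'M[Rmax R]_d :=
  \matrix_(i, j)
    if critical_arc i j then rmax_inv max_cycle_mean * A i j else 0.

Definition CSR (t : nat) : 'M[Rmax R]_d := csr_C *m csr_S ^+ t *m csr_R.

Definition nachtigall : 'M[Rmax R]_d :=
  \matrix_(i, j) if critical_node i || critical_node j then 0 else A i j.

Definition weak_csr_from (T : nat) : Prop :=
  forall t, (T <= t)%N ->
    A ^+ t = max_cycle_mean ^+ t *: CSR t + nachtigall ^+ t.

Definition is_T1N (T : nat) : Prop :=
  weak_csr_from T /\ forall T', weak_csr_from T' -> (T <= T')%N.

End MaxPlusMatrix.

(* Only used for n >= 1. *)
Definition Wi (n : nat) : nat := if (1 < n)%N then ((n - 1) ^ 2 + 1)%N else 0%N.

(* Main.v *)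
(* Write lam for the maximum cycle mean.  A walk of length t either avoids the
   critical nodes or is bounded by lam^t CS^tR, so the weak CSR identity at t only
   says that lam^t CS^tR <= A^t: a walk through a critical node, of length
   congruent to t modulo the cyclicity of the critical graph, is dominated by a
   walk of length exactly t.  By inserting critical closed walks, one may assume
   that it runs through a critical cycle Z of length g, the girth of its
   component, and that its length is congruent to t modulo g.

   If A = U L has inner dimension r, walks of A of length t.+1 lift to walks of the
   r x r matrix L U of length t, and Z lifts to a cycle without repetition because
   g is minimal.  It remains to shorten a walk of L U through Z modulo g.  Among
   those of maximal weight take a shortest one.  A node y visited m.+1 times gives
   m loops at y; any h = g / gamma of them contain a subfamily whose total length
   is a multiple of g, and which could be removed.  So nodes of Z are visited at
   most h times and the others at most h.+1 times, and it is enough to count the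
   visits to one cyclic class of small size.  If that class is contained in Z and
   has h elements and one of them is visited h times, then its loops are all
   congruent modulo g, hence may be replaced by copies of a single one, which
   improves h^2 visits to h (h - 1) + 2.  Finally the length is adjusted to t by
   copies of Z. *)

From HB Require Import structures.
From mathcomp Require Import all_boot all_order all_algebra.
From mathcomp Require Import boolp classical_sets reals zify.
(* Imported last: [arc] is the arc relation of G(A), not the one of path.v *)
Require Import Defs.

Set Implicit Arguments.
Unset Strict Implicit.
Unset Printing Implicit Defensive.

Import Order.TTheory GRing.Theory Num.Theory.
Local Open Scope ring_scope.

(** * The order of the max-plus semiring *)

Section RmaxOrder.
Variable R : realType.
Implicit Types x y z : Rmax R.

(** The canonical order of an idempotent semiring: sums are least upper bounds and [0], that is -oo,
    is the least element. *)
Definition rmax_le x y : bool := x + y == y.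

Fact rmax_le_refl : reflexive rmax_le.
Proof. by move=> [a|]; rewrite /rmax_le //= /GRing.add /= maxxx. Qed.

Fact rmax_le_anti : antisymmetric rmax_le.
Proof. by move=> x y /andP[/eqP h /eqP h']; rewrite -h addrC h'. Qed.

Fact rmax_le_trans : transitive rmax_le.
Proof. by move=> y x z /eqP h /eqP h'; rewrite /rmax_le -h' addrA h. Qed.

HB.instance Definition _ := Order.Le_isPOrder.Build ring_display (Rmax R)
  rmax_le_refl rmax_le_anti rmax_le_trans.

Fact rmax_le_total : total (<=%O : rel (Rmax R)).
Proof.
move=> x y; rewrite /Order.le /= /rmax_le [y + x]addrC.
case: x y => [a|] [b|]; rewrite /GRing.add /= ?eqxx ?orbT //.
by case: (leP a b) => _; rewrite eqxx ?orbT.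
Qed.

HB.instance Definition _ := Order.POrder_isTotal.Build ring_display (Rmax R)
  rmax_le_total.

Lemma rmaxE x y : (x <= y) = (x + y == y). Proof. by []. Qed.

Lemma rmax_leS (a b : R) : (Some a <= Some b :> Rmax R) = (a <= b).
Proof. by rewrite rmaxE [_ + _]/GRing.add /=; case: leP => h; apply/eqP => // -[e]; move: h; rewrite e ltxx. Qed.

Lemma rmax_le0x x : (0 : Rmax R) <= x. Proof. by rewrite rmaxE add0r. Qed.

Lemma rmax_lex0 x : (x <= 0) = (x == 0). Proof. by rewrite rmaxE addr0. Qed.

Lemma rmax_lexD x y : x <= x + y.
Proof. by rewrite rmaxE addrA (eqP (lexx x : _ + _ == _)). Qed.

Lemma rmax_leDx x y z : (x + y <= z) = (x <= z) && (y <= z).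
Proof.
apply/idP/andP=> [h | [/eqP h /eqP h']]; last by rewrite rmaxE -addrA h' h.
by split; apply: le_trans h; rewrite ?rmax_lexD // addrC rmax_lexD.
Qed.

Lemma rmax_leM x x' y y' : x <= x' -> y <= y' -> x * y <= x' * y'.
Proof.
move=> /eqP h /eqP h'; apply: (@le_trans _ _ (x' * y)).
  by rewrite rmaxE -mulrDl h.
by rewrite rmaxE -mulrDr h'.
Qed.

Lemma rmax_mul_eq0 x y : (x * y == 0) = (x == 0) || (y == 0).
Proof. by case: x y => [a|] [b|]. Qed.

Lemma rmax_mulVx x : x != 0 -> rmax_inv x * x = 1.
Proof. by case: x => [a|] // _; congr Some; rewrite addNr. Qed.

Lemma rmax_inv_eq0 x : (rmax_inv x == 0) = (x == 0).
Proof. by case: x. Qed.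

Lemma rmax_leM2l z x y : z != 0 -> (z * x <= z * y) = (x <= y).
Proof.
move=> z0; apply/idP/idP => [/(rmax_leM (lexx (rmax_inv z)))|]; last first.
  exact/rmax_leM.
by rewrite !mulrA rmax_mulVx // !mul1r.
Qed.

Lemma rmax_leMl1 x y : x <= 1 -> x * y <= y.
Proof. by move=> h; rewrite -{2}[y]mul1r rmax_leM. Qed.

Lemma rmax_leMr1 x y : x <= 1 -> y * x <= y.
Proof. by rewrite mulrC; apply: rmax_leMl1. Qed.

Lemma rmax_le_neq0 x y : x <= y -> x != 0 -> y != 0.
Proof. by move=> h; apply: contra => /eqP y0; move: h; rewrite y0 rmax_lex0. Qed.

Lemma rmax_expr_neq0 x n : x != 0 -> x ^+ n != 0.
Proof. by move=> x0; elim: n => // n IH; rewrite exprS rmax_mul_eq0 negb_or x0. Qed.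

Lemma rmax_sum_le (I : Type) (s : seq I) (P : pred I) (F : I -> Rmax R) z :
  (forall i, P i -> F i <= z) -> \sum_(i <- s | P i) F i <= z.
Proof.
move=> h; elim/big_ind: _ => //; first exact: rmax_le0x.
by move=> x y hx hy; rewrite rmax_leDx hx.
Qed.

Lemma rmax_le_sum (I : finType) (P : pred I) (F : I -> Rmax R) i :
  P i -> F i <= \sum_(j | P j) F j.
Proof. by move=> Pi; rewrite (bigD1 i) //= rmax_lexD. Qed.

Lemma rmax_sum_attained (I : finType) (P : pred I) (F : I -> Rmax R) :
  \sum_(j | P j) F j != 0 -> exists2 i, P i & \sum_(j | P j) F j = F i.
Proof.
elim/big_rec: _ => [|i x Pi IH]; first by rewrite eqxx.
have [h _|h _] := leP x (F i); first by exists i; rewrite // addrC; apply/eqP; rewrite -rmaxE.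
have /IH [j Pj e] : x != 0 by apply: contraTneq h => ->; rewrite -leNgt rmax_le0x.
by exists j; rewrite // -e; apply/eqP; rewrite -rmaxE ltW.
Qed.

(* [sup] is [0] on unbounded sets, whence the explicit bound [z]. *)
Lemma rmax_sup_ub (X : set (Rmax R)) z x :
  (forall y, X y -> y <= z) -> X x -> x <= rmax_sup X.
Proof.
move=> Xz; case: x => [a|] Xx; last exact: rmax_le0x.
rewrite /rmax_sup asboolT; last by exists a.
rewrite rmax_leS; apply: ub_le_sup => //=.
case: z Xz => [b|] Xz; last by have := Xz _ Xx; rewrite rmax_lex0.
by exists b => c /= /Xz; rewrite rmax_leS.
Qed.

Lemma rmax_sup_le (X : set (Rmax R)) z :
  (forall y, X y -> y <= z) -> rmax_sup X <= z.
Proof.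
rewrite /rmax_sup; case: asboolP => [[a Xa]|_] Xz; last exact: rmax_le0x.
case: z Xz => [b|] Xz; last by have := Xz _ Xa; rewrite rmax_lex0.
rewrite rmax_leS; apply: ge_sup; first by exists a.
by move=> c /= /Xz; rewrite rmax_leS.
Qed.

End RmaxOrder.

(** * Walks and powers of a max-plus matrix *)

Section Walks.
Variables (R : realType) (n : nat) (B : 'M[Rmax R]_n).
Implicit Types (x y : 'I_n) (p q : seq 'I_n).

(** As for [path], a walk is its first node [x] and the list [p] of the following nodes, so that
    [size p] counts its arcs. *)
Fixpoint wt x p : Rmax R := if p is y :: p' then B x y * wt y p' else 1.

Lemma wt_cat x p q : wt x (p ++ q) = wt x p * wt (last x p) q.
Proof. by elim: p x => [|y p IH] x /=; rewrite ?mul1r // IH mulrA. Qed.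

Lemma wt_rcons x p y : wt x (rcons p y) = wt x p * B (last x p) y.
Proof. by rewrite -cats1 wt_cat /= mulr1. Qed.

Lemma wt_pow x p : wt x p <= (B ^+ size p) x (last x p).
Proof.
elim: p x => [|y p IH] x /=; first by rewrite expr0 mxE eqxx.
rewrite exprS mxE (bigD1 y) //=.
by apply: le_trans (rmax_lexD _ _); rewrite rmax_leM.
Qed.

(** With [wt_pow]: an entry of a power is the largest weight of a walk of that length. *)
Lemma pow_wt t x y : (B ^+ t) x y != 0 ->
  exists p, [/\ size p = t, last x p = y & wt x p = (B ^+ t) x y].
Proof.
elim: t x => [|t IH] x.
  by rewrite expr0 mxE; case: (x =P y) => [<- _|_]; [exists [::] | rewrite eqxx].
rewrite exprS mxE => n0; have [z _ e] := rmax_sum_attained n0.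
move: n0; rewrite e rmax_mul_eq0 negb_or => /andP[_ /IH[p [hp1 hp2 hp3]]].
by exists (z :: p); rewrite /= hp1 hp2 hp3.
Qed.
End Walks.

(** * Zero-sum subsequences of residues *)

Section ZeroSum.
Variables (gamma h : nat).
Hypothesis (h_gt0 : (0 < h)%N).

(* Pigeonhole on the residues of the [h.+1] first prefix sums. *)
Lemma zero_sum_block (T : Type) (f : T -> nat) (s : seq T) :
  all (fun l => gamma %| f l)%N s -> (h <= size s)%N ->
  exists a b c, [/\ s = a ++ b ++ c, (0 < size b)%N
                  & (gamma * h %| \sum_(l <- b) f l)%N].
Proof.
move=> fs hs; pose S k := (\sum_(l <- take k s) f l)%N.
have Sdvd k : (gamma %| S k)%N.
  rewrite /S; elim: s k fs {S hs} => [|l s IH] k; first by rewrite big_nil.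
  by case: k => [|k] /=; rewrite ?big_nil // big_cons => /andP[? ?]; rewrite dvdn_add ?IH.
pose F (k : 'I_h.+1) : 'I_h := Ordinal (ltn_pmod (S k %/ gamma) h_gt0).
have /injectivePn[k1 [k2 ne /(congr1 val)/= e]] : ~~ injectiveb F.
  by apply/injectiveP => /leq_card; rewrite !card_ord ltnn.
wlog lt12 : k1 k2 ne e / (k1 < k2)%N.
  by move=> H; have [/H||/val_inj/eqP] := ltngtP k1 k2; rewrite ?(negPf ne) //;
     [apply | move/H; rewrite eq_sym; apply].
exists (take k1 s), (drop k1 (take k2 s)), (drop k2 s).
have E : take k2 s = take k1 s ++ drop k1 (take k2 s).
  by rewrite -{1}[take k2 s](cat_take_drop k1) take_takel // ltnW.
split.
- by rewrite catA -E cat_take_drop.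
- by rewrite size_drop size_takel ?subn_gt0 // (leq_trans _ hs) // -ltnS.
have e2 : S k2 = (S k1 + \sum_(l <- drop k1 (take k2 s)) f l)%N.
  by rewrite /S {1}E big_cat.
have -> : (\sum_(l <- drop k1 (take k2 s)) f l = S k2 - S k1)%N.
  by rewrite e2 addKn.
have /dvdnP[a1 e1'] := Sdvd k1; have /dvdnP[a2 e2'] := Sdvd k2.
have [g0|g0] := posnP gamma; first by rewrite e1' e2' g0 !muln0.
move: e; rewrite e1' e2' !mulnK // -mulnBl mulnC => e.
rewrite dvdn_pmul2r // -eqn_mod_dvd; first by rewrite e.
by rewrite -(leq_pmul2r g0) -e1' -e2' e2 leq_addr.
Qed.

Variable ns : seq nat.
Hypothesis ns_dvd : all (dvdn gamma) ns.
Hypothesis ns_size : size ns = h.-1.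
Hypothesis ns_free : forall b r, perm_eq ns (b ++ r) -> (0 < size b)%N ->
  ~~ (gamma * h %| sumn b)%N.

(** Prepending [k] gives [h] multiples of [gamma]; the zero-sum block among them must start at [k],
    since [ns] has none of its own. *)
Lemma zero_sum_free_complement k : (gamma %| k)%N ->
  exists b r, perm_eq ns (b ++ r) /\ (gamma * h %| k + sumn b)%N.
Proof.
move=> kd; have := @zero_sum_block _ id (k :: ns).
rewrite /= kd ns_dvd ns_size prednK // leqnn => -[//|//|a [b [c [e b0 bd]]]].
case: a e => [|k' a] /= e; last first.
  case: e => _ e; have := @ns_free b (a ++ c).
  by rewrite b0 sumnE bd e perm_catCA perm_refl => /(_ isT isT).
case: b e b0 bd => // k' b [<- e] _; rewrite big_cons => bd.
by exists b, c; rewrite e perm_refl sumnE.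
Qed.

(* The list below has the partial sums [0, v, u, u + v, u + v + ...]; a block
   with zero sum other than the second entry is one of [ns]. *)
Lemma zero_sum_free_congr u v : u \in ns -> v \in ns -> u = v %[mod gamma * h].
Proof.
have [-> //|ne] := eqVneq u v => us vs.
have p1 := perm_to_rem us; set r1 := rem u ns in p1.
have vr : v \in r1 by move: vs; rewrite (perm_mem p1) inE eq_sym (negPf ne).
have p2 := perm_to_rem vr; set r := rem v r1 in p2.
have pe : perm_eq ns (u :: v :: r) by rewrite (perm_trans p1) // perm_cons.
have hr : (size r).+3 = h by have := perm_size pe; rewrite ns_size /=; lia.
have g1 : (0 < gamma * h)%N.
  rewrite muln_gt0 h_gt0 andbT lt0n; apply/eqP => g0.
  have := @ns_free [:: u] (v :: r); rewrite pe /= g0 mul0n => /(_ isT isT)/negP; apply.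
  move/allP: ns_dvd => /(_ _ us); rewrite g0 => /dvdnP[k ->].
  by rewrite muln0.
have du : (gamma %| u)%N by move/allP: ns_dvd => ->.
have dv : (gamma %| v)%N by move/allP: ns_dvd => ->.
have dr : all (dvdn gamma) r.
  by apply/allP => k kr; apply: (allP ns_dvd); rewrite (perm_mem pe) !inE kr !orbT.
(* Modulo [gamma * h] the factor [(gamma * h).-1] stands for -1, so the second entry is [u - v]. *)
have [||a [b [c [e b0 bd]]]] :=
  @zero_sum_block _ id [:: v, (u + (gamma * h).-1 * v)%N, v & r].
- by rewrite /= dv dr dvdn_add // dvdn_mull.
- by rewrite /= hr.
- have key b' r' : perm_eq [:: u, v & r] (b' ++ r') -> (0 < size b')%N ->
      ~~ (gamma * h %| sumn b')%N.
    by move=> pb; apply: (@ns_free _ r'); apply: perm_trans pb.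
  have pd : ((gamma * h).-1 * v + v = gamma * h * v)%N by rewrite -{2}(prednK g1) mulSn addnC.
  have gd k m : (m = gamma * h * v + k)%N -> (gamma * h %| m)%N -> (gamma * h %| k)%N.
    by move=> ->; rewrite dvdn_addr // dvdn_mulr.
  move: ((gamma * h).-1 * v)%N pd gd bd e => P pd gd bd e.
  have absurd b' r' : perm_eq [:: u, v & r] (b' ++ r') -> (0 < size b')%N ->
      (gamma * h %| sumn b')%N -> u = v %[mod gamma * h].
    by move=> pb b0' bd'; have := key _ _ pb b0'; rewrite bd'.
  rewrite -sumnE in bd.
  (* The block starts at [v], at [u - v], at the second [v] or inside [r]. The block [u - v] alone
     gives the congruence; any other one has the sum of a subsequence of [ns]. *)
  case: a e => [|? [|? [|? a]]] /= [].
  + case: b b0 bd => // ? [|? [|? b]] _ /= bd [].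
    * move=> ve _; apply: (absurd [:: v] (u :: r)); rewrite ?ve //.
      by rewrite (perm_catCA [:: u] [:: _]).
    * move=> ve de _; apply: (absurd [:: u] (v :: r)) => //.
      by apply: gd bd; rewrite -ve -de -pd; clear=> /=; lia.
    * move=> ve de ve' e; rewrite -ve' in bd; apply: (absurd [:: u, v & b] c); rewrite /= ?e //.
      by apply: gd bd; rewrite -ve -de -pd; clear=> /=; lia.
  + move=> _; case: b b0 bd => // ? [|? b] _ /= bd [].
    * move=> de _; rewrite -(modnMDl v) mulnC -pd addnAC addnC.
      by move: bd; rewrite -de addn0 addnC => /dvdnP[k ->]; rewrite addnC modnMDl.
    * move=> de ve e; apply: (absurd (u :: b) (v :: c)) => //=.
        by rewrite e perm_cons (perm_catCA [:: v] b).
      by apply: gd bd; rewrite -ve -de -pd; clear=> /=; lia.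
  + move=> _ _; case: b b0 bd => // ? b _ /= bd [] ve e.
    apply: (absurd (v :: b) (u :: c)); rewrite ?ve //= e.
    by rewrite -[u :: _]/([:: u] ++ _) -[_ :: b ++ _]/((_ :: b) ++ _) perm_catCA.
  + move=> _ _ _ e; apply: (absurd b [:: u, v & a ++ c]) => //.
    by rewrite e (perm_catCA [:: u, v & a]).
Qed.
End ZeroSum.

(** * Walks decomposed into loops *)

Lemma perm_map_ex (T U : eqType) (f : T -> U) (s : seq T) (t : seq U) :
  perm_eq (map f s) t -> exists2 s', perm_eq s s' & t = map f s'.
Proof.
case: s => [|x s]; first by rewrite perm_sym => /perm_nilP ->; exists [::].
rewrite perm_sym => /(perm_iotaP (f x))[I pI ->].
rewrite size_map in pI; exists (map (nth x (x :: s)) I).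
  rewrite perm_sym; apply/(perm_iotaP x); exists I => //.
rewrite -map_comp; apply/eq_in_map => i.
by rewrite (perm_mem pI) mem_iota => /andP[_ il] /=; rewrite -(nth_map x (f x)).
Qed.

(** Carries a splitting of the loop lengths back to the loops themselves. *)
Lemma perm_map_cat_ex (T U : eqType) (f : T -> U) (s : seq T) (b r : seq U) :
  perm_eq (map f s) (b ++ r) ->
  exists sb sr, [/\ perm_eq s (sb ++ sr), b = map f sb & r = map f sr].
Proof.
move=> /perm_map_ex[s' ps e].
exists (take (size b) s'), (drop (size b) s').
by rewrite cat_take_drop map_take map_drop -e take_size_cat // drop_size_cat.
Qed.

Lemma count_sum_mem (T : finType) (D : {pred T}) (s : seq T) :
  count (mem D) s = (\sum_(y in D) count_mem y s)%N.
Proof.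
elim: s => [|x s IH] /=; first by rewrite big1.
rewrite big_split /= -IH; congr (_ + _)%N.
rewrite big_mkcond (bigD1 x) //= eqxx big1 ?addn0; first by case: (x \in D).
by move=> y ne; rewrite eq_sym (negPf ne); case: ifP.
Qed.

Lemma seq_argmax (T : eqType) (le : rel T) (s : seq T) :
  total le -> transitive le -> s != [::] ->
  exists2 m, m \in s & {in s, forall x, le x m}.
Proof.
move=> tot tr; elim: s => // x s IH _; case: (eqVneq s [::]) => [->|/IH[m ms mP]].
  exists x; rewrite ?mem_head // => y; rewrite inE => /eqP ->.
  by have := tot x x; rewrite orbb.
have /orP[xm|mx] := tot x m.
  by exists m; rewrite ?inE ?ms ?orbT // => y; rewrite inE => /predU1P[->|/mP].
exists x; rewrite ?mem_head // => y; rewrite inE => /predU1P[->|/mP ym].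
  by have := tot x x; rewrite orbb.
exact: tr mx.
Qed.

Section Loops.
Variables (R : realType) (n : nat) (B : 'M[Rmax R]_n).
Implicit Types (x y : 'I_n) (p q l : seq 'I_n) (ls : seq (seq 'I_n)).

Definition loop y l := (l != [::]) && (last y l == y).

Lemma last_loops y ls : all (loop y) ls -> last y (flatten ls) = y.
Proof. by elim: ls => //= l ls IH /andP[/andP[_ /eqP e] /IH]; rewrite last_cat e. Qed.

Lemma wt_loops y ls : all (loop y) ls ->
  wt B y (flatten ls) = \prod_(l <- ls) wt B y l.
Proof.
elim: ls => [|l ls IH] /=; first by rewrite big_nil.
by move=> /andP[/andP[_ /eqP e] /IH h]; rewrite wt_cat e big_cons h.
Qed.

Lemma size_loops ls : size (flatten ls) = (\sum_(l <- ls) size l)%N.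
Proof. by rewrite size_flatten sumnE big_map. Qed.

(** Cut at all visits of [y]: [p0] leads to the first one and [s] follows the last one. *)
Lemma split_loops x p y m : count_mem y (x :: p) = m.+1 ->
  exists p0 ls s, [/\ p = p0 ++ flatten ls ++ s, last x p0 = y,
                      all (loop y) ls & size ls = m].
Proof.
elim: p x m => [|z p IH] x m.
  move=> /=; case: eqP => // <- [<-].
  by exists [::], [::], [::].
rewrite [count_mem _ _]/=; case: (x =P y) => [xy|ne].
  rewrite add1n => -[]; case: m => [|m] e.
    by exists [::], [::], (z :: p).
  have [p0 [ls [s [-> e1 h1 h2]]]] := IH z m e.
  exists [::], ((z :: p0) :: ls), s; split => //=; first by rewrite catA.
    by rewrite /loop /= e1 eqxx.
  by rewrite h2.
rewrite add0n => e; have [p0 [ls [s [-> e1 h1 h2]]]] := IH z m e.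
by exists (z :: p0), ls, s.
Qed.

Hypothesis closed_le1 : forall x p, last x p = x -> wt B x p <= 1.

Lemma loops_le1 y ls : all (loop y) ls -> \prod_(l <- ls) wt B y l <= 1.
Proof.
by move=> h; rewrite -wt_loops // closed_le1 // last_loops.
Qed.

Variables (gamma : nat) (cl : 'I_n -> nat).
Hypothesis cl_arc : forall x y, B x y != 0 -> cl y = (cl x).+1 %[mod gamma].

(** [cl] gives the cyclic class of a node, which matters modulo [gamma] only. For [gamma = 1] any
    function will do. *)
Lemma cl_walk x p : wt B x p != 0 -> cl (last x p) = (cl x + size p)%N %[mod gamma].
Proof.
elim: p x => [|y p IH] x /=; first by rewrite addn0.
rewrite rmax_mul_eq0 negb_or => /andP[/cl_arc xy /IH ->].
by rewrite -modnDml xy modnDml addSnnS.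
Qed.

Lemma closed_dvdn x p : last x p = x -> wt B x p != 0 -> (gamma %| size p)%N.
Proof.
move=> e /cl_walk; rewrite e => /eqP.
by rewrite -{1}[cl x]addn0 eqn_modDl mod0n eq_sym.
Qed.

Lemma loops_dvdn y ls : all (loop y) ls -> \prod_(l <- ls) wt B y l != 0 ->
  all (fun l => gamma %| size l)%N ls.
Proof.
elim: ls => //= l ls IH /andP[/andP[_ /eqP e] /IH h].
rewrite big_cons rmax_mul_eq0 negb_or => /andP[w /h ->].
by rewrite andbT (closed_dvdn e w).
Qed.

Hypothesis gamma_gt0 : (0 < gamma)%N.

(** A walk meets a class every [gamma] steps, first after [tau] arcs. The inequalities say that [c]
    is [size (x :: p) - tau] divided by [gamma], rounded up. *)
Lemma class_count x p tau : wt B x p != 0 -> (tau < gamma)%N ->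
  let c := count (fun y => cl y == (cl x + tau)%N %[mod gamma]) (x :: p) in
  (size (x :: p) <= tau + gamma * c)%N /\
  (gamma * c + tau <= size (x :: p) + gamma.-1)%N.
Proof.
have same z k : (k < gamma)%N -> (cl z == (cl z + k)%N %[mod gamma]) = (k == 0)%N.
  by move=> kg; rewrite -{1}[cl z]addn0 eqn_modDl mod0n modn_small // eq_sym.
elim: p x tau => [|y p IH] x tau.
  move=> _ tg; rewrite /= addn0 same //.
  by case: tau tg => [|tau] tg; rewrite /= ?muln1 ?muln0; lia.
rewrite [wt _ _ _]/= rmax_mul_eq0 negb_or => /andP[xy w] tg.
have ey k : (cl y + k)%N = (cl x + k.+1)%N %[mod gamma] by rewrite -modnDml (cl_arc xy) modnDml addSnnS.
rewrite [count _ _]/= same //.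
case: tau tg => [|tau] tg.
  (* Offset 0 from [x] is offset [gamma.-1] from the next node [y]. *)
  have [] := IH y gamma.-1 w; first by rewrite prednK.
  have E : (fun z => cl z == (cl y + gamma.-1)%N %[mod gamma]) =1
           (fun z => cl z == (cl x + 0)%N %[mod gamma]).
    by move=> z /=; rewrite ey prednK // addn0 modnDr.
  by rewrite (eq_count E) /=; set k := (_ + count _ p)%N; rewrite mulnDr; lia.
have [] := IH y tau w (ltnW tg).
have E : (fun z => cl z == (cl y + tau)%N %[mod gamma]) =1
         (fun z => cl z == (cl x + tau.+1)%N %[mod gamma]).
  by move=> z /=; rewrite ey.
by rewrite (eq_count E) /=; set k := (_ + count _ p)%N; lia.
Qed.

End Loops.

(** * Optimal walks with prescribed residue *)

Section Splicing.
Variables (R : realType) (n : nat) (B : 'M[Rmax R]_n).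
Implicit Types (x y : 'I_n) (p q l s : seq 'I_n) (ls b r : seq (seq 'I_n)).

Definition splice p0 ls s : seq 'I_n := p0 ++ flatten ls ++ s.

Variables (x0 y : 'I_n) (p0 s : seq 'I_n).
Hypothesis p0y : last x0 p0 = y.

Lemma last_splice ls : all (loop y) ls -> last x0 (splice p0 ls s) = last y s.
Proof. by move=> h1; rewrite !last_cat p0y last_loops. Qed.

Lemma wt_splice ls : all (loop y) ls ->
  wt B x0 (splice p0 ls s) = \prod_(l <- ls) wt B y l * (wt B x0 p0 * wt B y s).
Proof.
by move=> h1; rewrite !wt_cat p0y last_loops // wt_loops // mulrCA.
Qed.

Lemma size_splice ls :
  size (splice p0 ls s) = (\sum_(l <- ls) size l + (size p0 + size s))%N.
Proof. by rewrite !size_cat size_loops addnCA. Qed.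

Lemma has_splice (a : pred 'I_n) ls : has a (x0 :: splice p0 ls s) =
  [|| has a (x0 :: p0), has a (flatten ls) | has a s].
Proof. by rewrite -cat_cons !has_cat. Qed.

End Splicing.

Section OptimalWalks.
Variables (R : realType) (n : nat) (B : 'M[Rmax R]_n).
Implicit Types (x y : 'I_n) (p q l s : seq 'I_n) (ls b r : seq (seq 'I_n)).
Hypothesis closed_le1 : forall x p, last x p = x -> wt B x p <= 1.
Variables (gamma h : nat) (cl : 'I_n -> nat).
Hypothesis gamma_gt0 : (0 < gamma)%N.
Hypothesis h_gt0 : (0 < h)%N.
Hypothesis cl_arc : forall x y, B x y != 0 -> cl y = (cl x).+1 %[mod gamma].
Variables (Z : {pred 'I_n}) (x0 j : 'I_n) (t : nat).

Definition good p := [&& last x0 p == j, has [in Z] (x0 :: p),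
  size p == t %[mod gamma * h] & wt B x0 p != 0].

Definition better q p :=
  [&& good q, wt B x0 p <= wt B x0 q & (size q < size p)%N].

Definition optimal p := good p /\ forall q, good q ->
  wt B x0 q <= wt B x0 p /\ (wt B x0 q = wt B x0 p -> (size p <= size q)%N).

Lemma optimal_not_better p q : optimal p -> ~~ better q p.
Proof.
move=> [_ opt]; apply/negP => /and3P[gq w sz]; have [w' sz'] := opt q gq.
have e : wt B x0 q = wt B x0 p by apply: le_anti; rewrite w' w.
by have := sz' e; rewrite leqNgt sz.
Qed.

Section Splice.
Variables (p0 s : seq 'I_n) (y : 'I_n).
Hypothesis p0y : last x0 p0 = y.

(** Loops weigh at most 1, the real number 0, so removing them does not lower the weight. That the
    remaining walk still meets [Z] has to be ensured separately. *)
Lemma drop_loops ls b r : all (loop y) ls -> perm_eq ls (b ++ r) ->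
  (0 < size b)%N -> (gamma * h %| \sum_(l <- b) size l)%N ->
  good (splice p0 ls s) -> has [in Z] (x0 :: splice p0 r s) ->
  better (splice p0 r s) (splice p0 ls s).
Proof.
move=> lls pls b0 bd /and4P[lst _ sz w] hZ.
have : all (loop y) (b ++ r) by rewrite -(perm_all _ pls).
rewrite all_cat => /andP[lb lr].
have W : wt B x0 (splice p0 ls s) <= wt B x0 (splice p0 r s).
  rewrite !(wt_splice _ _ p0y) // (perm_big _ pls) /= big_cat /= -mulrA.
  by rewrite rmax_leMl1 // loops_le1.
have S : size (splice p0 ls s) = (\sum_(l <- b) size l + size (splice p0 r s))%N.
  by rewrite !size_splice (perm_big _ pls) /= big_cat /= !addnA.
rewrite /better W /good hZ (rmax_le_neq0 W) // S.
rewrite (last_splice _ p0y) // -(last_splice s p0y lls) lst /=.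
move: sz; rewrite S -modnDml; move/eqP: bd => ->; rewrite add0n => -> /=.
case: b b0 lb {pls S} => // l b _ /= /andP[/andP[+ _] _].
by rewrite big_cons -size_eq0; move: (size _) => k; lia.
Qed.

(** Any [h] loops contain a removable family. If [y] is in [Z], the rest still meets [Z] at [y];
    otherwise a loop through [Z] may have to be set aside, whence one more loop. *)
Lemma many_loops_better ls : all (loop y) ls -> good (splice p0 ls s) ->
  (if y \in Z then h <= size ls else h < size ls)%N ->
  exists q, better q (splice p0 ls s).
Proof.
move=> lls gp hs; have /and4P[_ hZ _ w] := gp.
have lsd : all (fun l => gamma %| size l)%N ls.
  apply: (loops_dvdn cl_arc lls).
  by move: w; rewrite (wt_splice _ _ p0y) // rmax_mul_eq0 negb_or => /andP[].
have hls : (h <= size ls)%N by move: hs; case: ifP => // _ /ltnW.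
have [hZ'|] := boolP (has [in Z] (x0 :: p0) || has [in Z] s).
  have [a [b [c [e b0 bd]]]] := zero_sum_block h_gt0 lsd hls.
  exists (splice p0 (a ++ c) s); apply: (@drop_loops _ b) => //.
    by rewrite e perm_catCA.
  by rewrite has_splice orbCA hZ' orbT.
rewrite negb_or => /andP[hZ1 hZ2].
(* Only the loops meet [Z]: one that does, [l], is kept, and the removable family is taken among the
   others. *)
move: hZ; rewrite has_splice (negPf hZ1) (negPf hZ2) orbF /= => /hasP[z /flattenP[l ll zl] zZ].
have yZ : y \in Z = false.
  by apply: contraNF hZ1 => yZ; apply/hasP; exists y => //; rewrite -p0y mem_last.
rewrite yZ in hs; have pl := perm_to_rem ll; set r := rem l ls in pl.
have hr : (h <= size r)%N by have := perm_size pl; rewrite /= => e; rewrite -ltnS -e.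
have rd : all (fun l => gamma %| size l)%N r.
  by move: lsd; rewrite (perm_all _ pl) /= => /andP[].
have [a [b [c [e b0 bd]]]] := zero_sum_block h_gt0 rd hr.
exists (splice p0 (l :: a ++ c) s); apply: (@drop_loops _ b) => //.
  by rewrite (perm_trans pl) // e perm_sym (perm_catCA b [:: l]) /= perm_cons perm_catCA.
rewrite has_splice; apply/orP; right; apply/orP; left.
by apply/hasP; exists z => //=; rewrite mem_cat zl.
Qed.

End Splice.

Definition visits_bounded p :=
  forall y, (count_mem y (x0 :: p) <= h + (y \notin Z))%N.

Lemma visits_bounded_or_better p : good p ->
  visits_bounded p \/ exists q, better q p.
Proof.
move=> gp; have [vb|] := pselect (visits_bounded p); first by left.
move/existsNP => [y] /negP; rewrite -ltnNge => ly; right.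
case e : (count_mem y (x0 :: p)) ly => [//|m] ly.
have [p0 [ls [s [ep p0y lls sls]]]] := split_loops e.
rewrite ep in gp *; apply: (@many_loops_better p0 s y) => //; rewrite sls.
by move: ly; case: (y \in Z); rewrite ltnS /= ?addn0 ?addn1.
Qed.

Lemma reduce_walk p : good p -> exists q,
  [/\ good q, wt B x0 p <= wt B x0 q, (size q <= size p)%N & visits_bounded q].
Proof.
have [m] := ubnP (size p); elim: m p => // m IH p; rewrite ltnS => pm gp.
have [vb|[q /and3P[gq wq sq]]] := visits_bounded_or_better gp.
  by exists p; rewrite lexx leqnn.
have [q' [? w' s' ?]] := IH q (leq_trans sq pm) gq.
exists q'; split => //; first exact: le_trans w'.
exact: leq_trans s' (ltnW sq).
Qed.

Lemma visits_bounded_size p : visits_bounded p -> (size p < n * h.+1)%N.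
Proof.
move=> vb; rewrite -[X in (X <= _)%N]/(size (x0 :: p)) -(count_predT (x0 :: p)).
rewrite (@count_sum_mem _ predT) -[n in leqRHS](card_ord n) -sum_nat_const leq_sum //.
by move=> y _; apply: leq_trans (vb y) _; rewrite -addn1 leq_add2l leq_b1.
Qed.

(** Every good walk is dominated by one with bounded visits, hence of bounded length; the best of
    these finitely many walks is optimal. *)
Lemma optimal_ex p : good p -> exists q, optimal q.
Proof.
move=> gp; pose K := (n * h.+1)%N.
pose C := [seq q <- flatten [seq map val (enum {: k.-tuple 'I_n}) | k <- iota 0 K] | good q].
have memC q : good q -> visits_bounded q -> q \in C.
  move=> gq /visits_bounded_size qK; rewrite mem_filter gq /=.
  apply/flatten_mapP; exists (size q); first by rewrite mem_iota.
  by apply/mapP; exists (in_tuple q); rewrite ?mem_enum.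
(* Lexicographic: larger weight first, then smaller length. *)
pose le_opt q q' := (wt B x0 q < wt B x0 q') ||
   (wt B x0 q == wt B x0 q') && (size q' <= size q)%N.
have [|||q qC qmax] := @seq_argmax _ le_opt C.
- move=> a b; rewrite /le_opt.
  by case: ltgtP => //= _; case: leqP => //= /ltnW ->.
- move=> b a c /orP[ab|/andP[/eqP ab s1]] /orP[bc|/andP[/eqP bc s2]]; rewrite /le_opt.
  + by rewrite (lt_trans ab bc).
  + by rewrite -bc ab.
  + by rewrite ab bc.
  + by rewrite ab bc eqxx (leq_trans s2 s1) orbT.
- have [q1 [gq1 _ _ vb1]] := reduce_walk gp.
  by apply/negP => /eqP C0; have := memC _ gq1 vb1; rewrite C0.
exists q; split; first by move: qC; rewrite mem_filter => /andP[].
move=> q' /reduce_walk[q2 [gq2 w2 s2 vb2]]; have := qmax _ (memC _ gq2 vb2).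
rewrite /le_opt => /orP[lt|/andP[/eqP e s3]].
  have lt' := le_lt_trans w2 lt.
  by split; [exact: ltW | move=> e; rewrite e ltxx in lt'].
by rewrite -e; split => // _; apply: leq_trans s2.
Qed.

Lemma optimal_bounded p : optimal p -> visits_bounded p.
Proof.
move=> op; have [//|[q bq]] := visits_bounded_or_better op.1.
by have := optimal_not_better q op; rewrite bq.
Qed.

Lemma optimal_le p q : optimal p -> good q -> wt B x0 q <= wt B x0 p.
Proof. by move=> [_ H] /H[]. Qed.

(** Sum the bounds on visits over [D]: [h] per node, plus one for each node outside [Z], of which
    there are at most [#|D| - h]. *)
Lemma optimal_count (D : {set 'I_n}) p : optimal p ->
  (h <= #|D :&: [set y in Z]|)%N ->
  (count [in D] (x0 :: p) + h <= h * #|D| + #|D|)%N.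
Proof.
move=> /optimal_bounded vb hD; rewrite count_sum_mem.
have H : (\sum_(y in D) count_mem y (x0 :: p) <= h * #|D| + \sum_(y in D) (y \notin Z))%N.
  by rewrite mulnC -sum_nat_const -big_split leq_sum.
have : (\sum_(y in D) (y \notin Z) + \sum_(y in D) (y \in Z) = #|D|)%N.
  rewrite -big_split /= -sum1_card; apply: eq_bigr => y _; by case: (y \in Z).
have : (\sum_(y in D) (y \in Z) = #|D :&: [set y in Z]|)%N.
  rewrite -sum1_card big_mkcond [RHS]big_mkcond /=; apply: eq_bigr => y _.
  by rewrite !inE; case: (y \in D) => //=; case: (y \in Z).
by move: H; set c := (\sum_(y in D) count_mem _ _)%N; lia.
Qed.

Section Saturated.
Variables (D : {set 'I_n}) (c : nat).
Hypothesis DE : D = [set y | cl y == c %[mod gamma]].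
Hypothesis DZ : {subset D <= Z}.
Hypothesis Dh : #|D| = h.

Lemma closed_class_count x l : x \in D -> last x l = x -> wt B x l != 0 ->
  (size l = gamma * count [in D] l)%N.
Proof.
move=> xD xl wl; have [k1 k2] := class_count cl_arc gamma_gt0 wl gamma_gt0.
have E : (fun y => cl y == (cl x + 0)%N %[mod gamma]) =1 [in D].
  move=> y; rewrite addn0 /= DE inE; move: xD; rewrite DE inE => /eqP ->.
  by [].
have /dvdnP[k ek] := closed_dvdn cl_arc xl wl.
move: k1 k2; rewrite !(eq_count E) /= xD addn0 ek; set m := count _ _ => k1 k2.
have : (k * gamma < m.+1 * gamma)%N by rewrite mulSn [(m * _)%N]mulnC; lia.
have : (m * gamma < k.+1 * gamma)%N by rewrite mulSn [(m * _)%N]mulnC; lia.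
rewrite !ltn_pmul2r // !ltnS => mk km.
by rewrite mulnC; congr (_ * _)%N; apply/eqP; rewrite eqn_leq km.
Qed.

Lemma good_through x p0 ls s : x \in D -> last x0 p0 = x ->
  all (loop x) ls -> last x s = j ->
  size (splice p0 ls s) = t %[mod gamma * h] -> wt B x0 (splice p0 ls s) != 0 ->
  good (splice p0 ls s).
Proof.
move=> xD p0x lls sj st w; rewrite /good (last_splice _ p0x) // sj st w !eqxx /= andbT.
rewrite -[_ || _]/(has [in Z] (x0 :: splice p0 ls s)) has_splice.
by apply/orP; left; apply/hasP; exists x; rewrite ?DZ // -p0x mem_last.
Qed.

(** By optimality the lengths of the [h.-1] loops at [x] form a zero-sum free list of maximal
    length, so they are congruent; optimality then makes the loops equal in weight and length. Once
    all are replaced by copies of one loop [I], some node of [D] is missed by [I] and visited at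
    most twice. *)
Lemma optimal_saturated p x : (2 < h)%N -> optimal p -> x \in D ->
  (h <= count_mem x (x0 :: p))%N ->
  exists q, [/\ good q, wt B x0 q = wt B x0 p, size q = size p
              & (count [in D] (x0 :: q) <= h * h.-1 + 2)%N].
Proof.
move=> h2 op xD hx.
have ex : count_mem x (x0 :: p) = h.-1.+1.
  apply/eqP; rewrite prednK // eqn_leq hx andbT.
  by have := optimal_bounded op x; rewrite DZ // addn0.
have [p0 [ls [s [ep p0x lls sls]]]] := split_loops ex.
move: op; rewrite {p ex hx}ep -/(splice p0 ls s) => op.
have /and4P[/eqP lst _ /eqP szt w] := op.1.
have sj : last x s = j by rewrite -lst (last_splice _ p0x).
have [w_ls w_rest] : \prod_(l <- ls) wt B x l != 0 /\ wt B x0 p0 * wt B x s != 0.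
  by apply/andP; rewrite -negb_or -rmax_mul_eq0 -(wt_splice _ _ p0x).
have lsd := loops_dvdn cl_arc lls w_ls.
have nsd : all (dvdn gamma) (map size ls) by rewrite all_map.
have nss : size (map size ls) = h.-1 by rewrite size_map.
have nsf (b r : seq nat) : perm_eq (map size ls) (b ++ r) -> (0 < size b)%N ->
    ~~ (gamma * h %| sumn b)%N.
  move=> /perm_map_cat_ex[lb [lr [pls -> _]]] b0; apply/negP => bd.
  have : better (splice p0 lr s) (splice p0 ls s).
    apply: (drop_loops p0x lls pls) op.1 _.
    - by move: b0; rewrite size_map.
    - by move: bd; rewrite sumnE big_map.
    - rewrite has_splice; apply/orP; left; apply/hasP; exists x; rewrite ?DZ //.
      by rewrite -p0x mem_last.
  by apply/negP; apply: optimal_not_better.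
(* A closed part [l] of the outer walk could be dropped together with loops that complete its length
   to a multiple of [gamma * h], against optimality. *)
have shortcut p0' s' l : last x0 p0' = x -> last x s' = j ->
    (gamma %| size l)%N -> (0 < size l)%N ->
    (size p0 + size s = size l + (size p0' + size s'))%N ->
    wt B x0 p0 * wt B x s <= wt B x0 p0' * wt B x s' -> False.
  move=> p0x' sj' ld l0 es ew.
  have [b [r [pbr bd]]] := zero_sum_free_complement h_gt0 nsd nss nsf ld.
  have [b' [r' [pls e _]]] := perm_map_cat_ex pbr.
  have eb : sumn b = (\sum_(l <- b') size l)%N by rewrite e sumnE big_map.
  have : all (loop x) (b' ++ r') by rewrite -(perm_all _ pls).
  rewrite all_cat => /andP[lb lr].
  have W : wt B x0 (splice p0 ls s) <= wt B x0 (splice p0' r' s').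
    rewrite (wt_splice _ _ p0x) // (wt_splice _ _ p0x') // (perm_big _ pls) /= big_cat /=.
    by rewrite rmax_leM // rmax_leMl1 // loops_le1.
  have S : size (splice p0 ls s) = (size l + sumn b + size (splice p0' r' s'))%N.
    rewrite !size_splice es (perm_big _ pls) /= big_cat /= eb addnACA.
    by congr (_ + _)%N; rewrite addnC.
  have : better (splice p0' r' s') (splice p0 ls s).
    rewrite /better W S andbC (@good_through x) //.
    - by rewrite -{1}[size _]add0n ltn_add2r addn_gt0 l0.
    - by rewrite -szt S -modnDml; move/eqP: bd => ->.
    - exact: rmax_le_neq0 W w.
  by apply/negP; apply: optimal_not_better.
(* Hence neither [p0] nor, below, [s] repeats a node. *)
have simple0 y : (count_mem y (x0 :: p0) <= 1)%N.
  rewrite leqNgt; apply/negP; case e : (count_mem _ _) => [|[|m]] // _.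
  have [u [[|l ls'] [v [ep uy ll // _]]]] := split_loops e.
  have /= /andP[/andP[l0 /eqP ly] lls'] := ll.
  rewrite -/(splice u (l :: ls') v) in ep.
  have := wt_splice B v uy ll; rewrite -ep big_cons => ew.
  have l_dvd : (gamma %| size l)%N.
    apply: (closed_dvdn cl_arc ly); move: w_rest; rewrite ew !rmax_mul_eq0 !negb_or.
    by case/andP => /andP[/andP[]].
  apply: (@shortcut (splice u ls' v) s l) => //.
  - by rewrite (last_splice _ uy) // -p0x ep (last_splice _ uy).
  - by rewrite lt0n size_eq0.
  - by rewrite ep !size_splice big_cons !addnA.
  - by rewrite ew (wt_splice _ _ uy) // rmax_leM // -mulrA rmax_leMl1 // closed_le1.
have simple1 y : (count_mem y (x :: s) <= 1)%N.
  rewrite leqNgt; apply/negP; case e : (count_mem _ _) => [|[|m]] // _.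
  have [u [[|l ls'] [v [ep uy ll // _]]]] := split_loops e.
  have /= /andP[/andP[l0 /eqP ly] lls'] := ll.
  rewrite -/(splice u (l :: ls') v) in ep.
  have := wt_splice B v uy ll; rewrite -ep big_cons => ew.
  have l_dvd : (gamma %| size l)%N.
    apply: (closed_dvdn cl_arc ly); move: w_rest; rewrite ew !rmax_mul_eq0 !negb_or.
    by case/andP => _ /andP[/andP[]].
  apply: (@shortcut p0 (splice u ls' v) l) => //.
  - by rewrite (last_splice _ uy) // -sj ep (last_splice _ uy).
  - by rewrite lt0n size_eq0.
  - by rewrite ep !size_splice big_cons -addnA addnCA.
  - by rewrite ew (wt_splice _ _ uy) // rmax_leM // -mulrA rmax_leMl1 // closed_le1.
have [I Ils] : exists I, I \in ls.
  by case: ls sls {lls op lst szt w w_ls lsd nsd nss nsf shortcut} => [/=|I ls' _]; [lia|exists I; rewrite mem_head].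
have prod_neq0 u r : perm_eq ls (u :: r) -> wt B x u != 0 /\ \prod_(l <- r) wt B x l != 0.
  by move=> pl; move: w_ls; rewrite (perm_big _ pl) /= big_cons rmax_mul_eq0 negb_or => /andP.
(* Exchanging [u] for a second copy of [v] keeps the residue, so it cannot improve the optimal walk;
   by symmetry all loops agree. *)
have swap u v : u \in ls -> v \in ls ->
    wt B x v <= wt B x u /\ (wt B x v = wt B x u -> (size u <= size v)%N).
  move=> us vs; have pl := perm_to_rem us; have [wu wr] := prod_neq0 _ _ pl.
  have [wv _] := prod_neq0 _ _ (perm_to_rem vs).
  set r := rem u ls in pl wr.
  have lr : all (loop x) (u :: r) by rewrite -(perm_all _ pl).
  have lvr : all (loop x) (v :: r) by move: lr; rewrite /= (allP lls v vs) => /andP[].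
  have W k : wt B x k * \prod_(l <- r) wt B x l * (wt B x0 p0 * wt B x s) =
      \prod_(l <- r) wt B x l * (wt B x0 p0 * wt B x s) * wt B x k.
    by rewrite -mulrA mulrC.
  have wls : wt B x0 (splice p0 ls s) = \prod_(l <- r) wt B x l * (wt B x0 p0 * wt B x s) * wt B x u.
    by rewrite (wt_splice _ _ p0x) // (perm_big _ pl) /= big_cons W.
  have wvr : wt B x0 (splice p0 (v :: r) s) = \prod_(l <- r) wt B x l * (wt B x0 p0 * wt B x s) * wt B x v.
    by rewrite (wt_splice _ _ p0x) // big_cons W.
  have c0 : \prod_(l <- r) wt B x l * (wt B x0 p0 * wt B x s) != 0.
    by rewrite rmax_mul_eq0 negb_or wr.
  have gv : good (splice p0 (v :: r) s).
    apply: (@good_through x) => //; last by rewrite wvr rmax_mul_eq0 negb_or c0.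
    rewrite -szt !size_splice (perm_big _ pl) /= !big_cons -!addnA -modnDml -[RHS]modnDml.
    by congr ((_ + _) %% _)%N; apply: zero_sum_free_congr nsd nss nsf _ _ _ _; rewrite ?map_f.
  have [] := op.2 _ gv; rewrite wls wvr rmax_leM2l // => ? H; split=> // e.
  have := H (congr1 _ e); rewrite !size_splice (perm_big _ pl) /= !big_cons.
  by rewrite !leq_add2r.
have all_same l : l \in ls -> wt B x l = wt B x I /\ size l = size I.
  move=> lin; have [w1 s1] := swap _ _ lin Ils; have [w2 s2] := swap _ _ Ils lin.
  have e : wt B x l = wt B x I by apply: le_anti; rewrite w1 w2.
  by split=> //; apply/eqP; rewrite eqn_leq s1 // s2.
pose rs := [seq I | _ <- ls]; exists (splice p0 rs s).
have lrs : all (loop x) rs.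
  by apply/allP => l /mapP[_ _ ->]; apply: (allP lls).
have wq : wt B x0 (splice p0 rs s) = wt B x0 (splice p0 ls s).
  rewrite !(wt_splice _ _ p0x) //; congr (_ * _).
  by rewrite big_map; apply: eq_big_seq => l /all_same[].
have sq : size (splice p0 rs s) = size (splice p0 ls s).
  rewrite !size_splice big_map; congr (_ + _)%N.
  by apply: eq_big_seq => l /all_same[].
have gq : good (splice p0 rs s) by apply: (@good_through x); rewrite ?sq ?wq.
have oq : optimal (splice p0 rs s) by split=> // q /op.2; rewrite wq sq.
split=> //.
have Ix : last x I = x by have /andP[_ /eqP] := allP lls _ Ils.
have wI : wt B x I != 0 by have [] := prod_neq0 _ _ (perm_to_rem Ils).
have I0 : (0 < size I)%N.
  by have /andP[+ _] := allP lls _ Ils; rewrite lt0n size_eq0.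
have cq y : count_mem y (x0 :: splice p0 rs s) =
    (count_mem y (x0 :: p0) + (h.-1 * count_mem y I + count_mem y s))%N.
  rewrite -cat_cons !count_cat; congr (_ + (_ + _))%N.
  by rewrite -sls /rs; elim: (ls) => //= l ls' IH; rewrite count_cat IH mulSn.
(* Each visit in [I] counts [h.-1] times; two of them would exceed [h], as [2 < h]. *)
have cI y : y \in D -> (count_mem y I <= 1)%N.
  move=> yD; have := optimal_bounded oq y; rewrite cq DZ // addn0.
  case: (count_mem y I) => [|[|m]] // H; have L : (h.-1 * 2 <= h.-1 * m.+2)%N by rewrite leq_mul2l orbT.
  have := leq_trans L (leq_trans (leq_addr _ _) (leq_trans (leq_addl _ _) H)).
  by move: h2; clear; lia.
(* If [I] went through all of [D], its length would be [gamma * h] and it could be removed. *)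
have [y1 y1D y1I] : exists2 y1, y1 \in D & y1 \notin I.
  apply/exists_inP; rewrite -negb_forall_in; apply/negP => /forall_inP DI.
  have eI : count [in D] I = h.
    rewrite count_sum_mem -Dh -sum1_card; apply: eq_bigr => y yD.
    by apply/eqP; rewrite eqn_leq cI // -has_count has_pred1 DI.
  have := @nsf [:: size I] _ (perm_map size (perm_to_rem Ils)) isT.
  by rewrite /= addn0 (closed_class_count xD Ix wI) eI dvdnn.
(* The extra term records the saving at [y1], visited at most once in [p0] and once in [s]. *)
have ub y : y \in D -> (count_mem y (x0 :: splice p0 rs s) + (h - 2) * (y == y1) <= h)%N.
  move=> yD; have := optimal_bounded oq y; rewrite DZ // addn0.
  case: (y =P y1) => [->|_]; last by rewrite muln0 addn0.
  move=> _; rewrite cq (count_memPn y1I) muln0 add0n muln1.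
  have := simple0 y1; have := simple1 y1; rewrite [count_mem y1 (x :: s)]/=.
  by move: (count_mem _ _) (count_mem _ _) h2 => a b; clear; lia.
have : (\sum_(y in D) (count_mem y (x0 :: splice p0 rs s) + (h - 2) * (y == y1)) <= h * h)%N.
  by rewrite -[X in (_ <= X * _)%N]Dh -sum_nat_const; apply: leq_sum.
rewrite big_split -count_sum_mem /= (bigD1 y1 y1D) /= eqxx big1 => [|y /andP[_ /negPf ->]]; last by rewrite muln0.
rewrite muln1 addn0; move: (_ + count _ _)%N h2 => a; clear.
by case: (h) => // k; rewrite mulSn /= mulnC mulSn; lia.
Qed.

(** For [h] at most 2 the general count [h * h] suffices. Otherwise either some node of [D] is
    visited [h] times, or each at most [h.-1] times. *)
Lemma optimal_count_square p : optimal p ->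
  exists q, [/\ good q, wt B x0 q = wt B x0 p, size q = size p
              & (count [in D] (x0 :: q) <= h * h.-1 + minn h 2)%N].
Proof.
move=> op; have hD : (h <= #|D :&: [set y in Z]|)%N.
  by rewrite (finset.setIidPl _) ?Dh //; apply/fintype.subsetP => y /DZ; rewrite inE.
have [h2|h2] := leqP h 2.
  exists p; split=> //; first exact: op.1.
  have := optimal_count op hD; rewrite Dh; set a := count _ _.
  by case: (h) h_gt0 h2 => [|[|[|]]] //= _ _; rewrite ?leq_add2r; lia.
have [[x xD hx]|H] := pselect (exists2 x, x \in D & h <= count_mem x (x0 :: p))%N.
  exact: optimal_saturated hx.
exists p; split=> //; first exact: op.1.
apply: leq_trans (leq_addr _ _); rewrite count_sum_mem -{1}Dh -sum_nat_const.
apply: leq_sum => y yD; rewrite -ltnS prednK // ltnNge; apply/negP => hy.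
by apply: H; exists y.
Qed.
End Saturated.
End OptimalWalks.

(** * Small cyclic classes and the arithmetic of the bounds *)

Lemma sum_leq_const m k : (\sum_(i < m) (i <= k) = minn m k.+1)%N.
Proof.
elim: m => [|m IH]; first by rewrite big_ord0 min0n.
by rewrite big_ord_recr /= IH; case: leqP; lia.
Qed.

(* If the classes at offsets [0 .. n %% gamma] all had more than [n %/ gamma]
   elements and the others at least [n %/ gamma], they would not fit in ['I_n]. *)
Lemma small_class n (cl : 'I_n -> nat) gamma k : (0 < gamma)%N ->
  exists2 tau, (tau < gamma)%N &
    let m := #|[set y | cl y == (k + tau)%N %[mod gamma]]| in
    (tau <= n %% gamma)%N && (m <= n %/ gamma)%N || (m < n %/ gamma)%N.
Proof.
move=> g0; pose D tau := [set y | cl y == (k + tau)%N %[mod gamma]].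
have H0 : (\sum_(tau < gamma) #|D tau| <= n)%N.
  have -> : (\sum_(tau < gamma) #|D tau| =
             \sum_(y < n) \sum_(tau < gamma) (y \in D tau))%N.
    rewrite exchange_big; apply: eq_bigr => tau _.
    by rewrite -sum1_card big_mkcond; apply: eq_bigr => y _; case: (y \in _).
  rewrite -[n in leqRHS]card_ord -sum1_card; apply: leq_sum => y _.
  have -> : (\sum_(tau < gamma) (y \in D tau) = #|[pred tau : 'I_gamma | y \in D tau]|)%N.
    by rewrite -sum1_card [RHS]big_mkcond; apply: eq_bigr => i _; rewrite [in RHS]inE; case: (y \in _).
  apply/card_le1_eqP => a b; rewrite !inE => /eqP -> /eqP /eqP.
  by rewrite eqn_modDl !modn_small // => /eqP/val_inj.
have [[tau P]|H] := pselect (exists tau : 'I_gamma, (tau <= n %% gamma)%N && (#|D tau| <= n %/ gamma)%N || (#|D tau| < n %/ gamma)%N).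
  by exists tau.
exfalso; suff : (\sum_(tau < gamma) (n %/ gamma + (tau <= n %% gamma)) <= \sum_(tau < gamma) #|D tau|)%N.
  rewrite big_split /= sum_nat_const card_ord sum_leq_const.
  have := ltn_pmod n g0; have := divn_eq n gamma; move: H0; rewrite mulnC.
  move: (\sum_(_ < _) _)%N (n %/ gamma * gamma)%N (n %% gamma)%N => a b c; clear.
  lia.
apply: leq_sum => tau _; rewrite leqNgt; apply/negP => lt; apply: H; exists tau.
move: lt; case: (tau <= n %% gamma)%N; rewrite ?addn1 ?addn0 ?ltnS => -> //.
Qed.

(** Here [k] counts the nodes of the walk, [c] the visits to a class of [m] nodes, and
    [q * gamma + rho] is the dimension. An offset [tau] beyond [rho] is paid for by the class having
    fewer than [q] nodes. *)
Lemma small_class_bound gamma h m q rho tau c k : (tau < gamma)%N ->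
  (tau <= rho)%N && (m <= q)%N || (m < q)%N -> (h <= m)%N ->
  (c + h <= h * m + m)%N -> (k <= tau + gamma * c)%N ->
  (k + gamma * h <= gamma * h * q + (q * gamma + rho))%N.
Proof.
move=> tg small hm cb kb.
have l1 : (gamma * (c + h) <= gamma * (h.+1 * m))%N.
  by rewrite leq_mul2l mulSn [(m + _)%N]addnC cb orbT.
have e q' : (gamma * (h.+1 * q') = gamma * h * q' + q' * gamma)%N by rewrite mulSn mulnDr addnC mulnA [(gamma * q')%N]mulnC.
case/orP: small => [/andP[tr mq]|mq].
  have l2 : (gamma * (h.+1 * m) <= gamma * (h.+1 * q))%N by rewrite !leq_mul.
  move: l1 l2; rewrite (e q) mulnDr; lia.
have l2 : (gamma * (h.+1 * m.+1) <= gamma * (h.+1 * q))%N by rewrite !leq_mul.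
move: l1 l2; rewrite (e q) mulnDr [(h.+1 * m.+1)%N]mulnS mulnDr mulnS; lia.
Qed.

(** For [h < q] the girth bound thus implies the one with [Wi]; equality holds at [q = h.+1]. *)
Lemma Wi_square_gap h q : (0 < h < q)%N -> (h * q + q <= Wi q + 2 * h)%N.
Proof.
case/andP=> h0 hq; rewrite /Wi (leq_ltn_trans h0 hq).
have [k ->] : exists k, q = (h + k.+1)%N by exists (q - h).-1; lia.
by rewrite addnS subn1 /= expnS expn1; nia.
Qed.

(** Expresses the count of [optimal_count_square] by [Wi], for the case where [h] is as large as
    possible. *)
Lemma Wi_square h : (0 < h)%N -> (h * h.-1 + minn h 2 = Wi h + h)%N.
Proof. by case: h => [|[|h]] // _; rewrite /Wi /= subn1 /= expnS expn1 minnE; nia. Qed.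

(** * Walks that meet a critical cycle *)

Section CriticalWalks.
Variables (R : realType) (n : nat) (B : 'M[Rmax R]_n).
Hypothesis closed_le1 : forall x p, last x p = x -> wt B x p <= 1.
Variables (gamma : nat) (cl : 'I_n -> nat).
Hypothesis gamma_gt0 : (0 < gamma)%N.
Hypothesis cl_arc : forall x y, B x y != 0 -> cl y = (cl x).+1 %[mod gamma].
Variables (z : 'I_n) (Z : seq 'I_n).
Hypothesis Z_uniq : uniq (z :: Z).
Hypothesis Z_wt : wt B z (rcons Z z) = 1.
Let g := size (z :: Z).

Lemma cycle_length_dvdn : (gamma %| g)%N.
Proof.
have := @closed_dvdn _ _ _ _ _ cl_arc z (rcons Z z).
by rewrite last_rcons Z_wt size_rcons; apply.
Qed.

Lemma cycle_length_le : (g <= n)%N.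
Proof. by rewrite /g -[n in leqRHS]card_ord -(card_uniqP Z_uniq) max_card. Qed.

(** The cycle winds [g %/ gamma] times around the classes without repeating a node. *)
Lemma cycle_meets_class c :
  (g %/ gamma <= #|[set y | cl y == c %[mod gamma]] :&: [set y in z :: Z]|)%N.
Proof.
(* The offset of the class [c] from that of [z]: multiplying by [gamma.-1] changes the sign modulo
   [gamma]. *)
pose tau := ((c + cl z * gamma.-1) %% gamma)%N.
have tau_lt : (tau < gamma)%N by rewrite ltn_mod.
have ec : (cl z + tau)%N = c %[mod gamma].
  rewrite modnDmr addnCA -[X in (c + (X + _))%N]muln1 -mulnDr add1n prednK //.
  by rewrite addnC modnMDl.
have wZ : wt B z Z != 0.
  have : wt B z (rcons Z z) != 0 by rewrite Z_wt.
  by rewrite wt_rcons rmax_mul_eq0 negb_or => /andP[].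
have [+ _] := class_count cl_arc gamma_gt0 wZ tau_lt.
rewrite -size_filter -(card_uniqP (filter_uniq _ Z_uniq)).
set k := #|_|; set k' := #|_|.
have -> : k = k'.
  by apply: eq_card => y; rewrite mem_filter !inE ec.
rewrite -/g => H; rewrite -ltnS -(ltn_pmul2r gamma_gt0) divnK ?cycle_length_dvdn //.
by apply: leq_ltn_trans H _; rewrite mulSn [(k' * _)%N]mulnC ltn_add2r.
Qed.

(** The length of an optimal walk is read off from its visits to a small class. The second bound
    follows from the first if [g %/ gamma < n %/ gamma]; otherwise the cycle fills that class and
    the sharper count applies. *)
Lemma bound_through_cycle x p : has [in z :: Z] (x :: p) -> wt B x p != 0 ->
  exists q, [/\ last x q = last x p, has [in z :: Z] (x :: q),
    size q = size p %[mod g], wt B x p <= wt B x q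
  & (size q + 1 + g <= g * (n %/ gamma) + n)%N /\
    (size q + 1 <= gamma * Wi (n %/ gamma) + n %% gamma + g)%N].
Proof.
move=> hZ wp; pose h := (g %/ gamma)%N.
have gh : g = (gamma * h)%N by rewrite mulnC divnK // cycle_length_dvdn.
have h_gt0 : (0 < h)%N by rewrite divn_gt0 // dvdn_leq // cycle_length_dvdn.
pose gd := good B gamma h [in z :: Z] x (last x p) (size p).
have gp : gd p by rewrite /gd /good !eqxx hZ.
have goodP q : gd q -> wt B x p <= wt B x q -> [/\ last x q = last x p,
    has [in z :: Z] (x :: q), size q = size p %[mod g] & wt B x p <= wt B x q].
  by rewrite /gd /good -gh => /and4P[/eqP ? ? /eqP ? _] ?.
have [p1 op] := optimal_ex closed_le1 gamma_gt0 h_gt0 cl_arc gp.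
have p1w := optimal_le op gp.
have [tau tau_lt] := small_class cl (cl x) gamma_gt0; set D := [set y | _] => /= small.
have [p1_size _] := class_count cl_arc gamma_gt0 (let: And4 _ _ _ w := and4P op.1 in w) tau_lt.
have ED q : count (fun y => cl y == (cl x + tau)%N %[mod gamma]) (x :: q) = count [in D] (x :: q).
  by apply: eq_count => y; rewrite /= inE.
rewrite ED in p1_size.
have hD : (h <= #|D :&: [set y in z :: Z]|)%N by apply: cycle_meets_class.
have hm : (h <= #|D|)%N by apply: leq_trans hD (subset_leq_card (subsetIl _ _)).
have cD := optimal_count closed_le1 gamma_gt0 h_gt0 cl_arc op hD.
have en := divn_eq n gamma.
have sizeA (q : seq 'I_n) : size q = size p1 -> (size q + 1 + g <= g * (n %/ gamma) + n)%N.
  move=> ->; rewrite addn1 gh.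
  by have := small_class_bound tau_lt small hm cD p1_size; rewrite -en.
have [hq|qh] := ltnP h (n %/ gamma).
  have [? ? ? ?] := goodP _ op.1 p1w; exists p1; split=> //; split; first exact: sizeA.
  have l1 : (gamma * (h * (n %/ gamma) + n %/ gamma) <= gamma * (Wi (n %/ gamma) + 2 * h))%N.
    by rewrite leq_mul2l Wi_square_gap ?h_gt0 // orbT.
  have := sizeA p1 erefl; rewrite gh.
  move: l1 en; rewrite !mulnDr [(n %/ gamma * gamma)%N]mulnC.
  rewrite [(gamma * (h * (n %/ gamma)))%N]mulnA muln0.
  by move: (gamma * h * _)%N (gamma * (n %/ gamma))%N; clear; lia.
(* Now the cycle has at least [n %/ gamma] nodes in each class. So the small class consists of
   exactly [h] nodes of the cycle, and its offset is at most [n %% gamma]. *)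
have mQ : (#|D| <= n %/ gamma)%N by case/orP: small => [/andP[]|/ltnW].
have eh : h = (n %/ gamma)%N by apply/eqP; rewrite eqn_leq (leq_trans hm mQ).
have Dh : #|D| = h by apply/eqP; rewrite eqn_leq hm andbT (leq_trans mQ qh).
have tau_rho : (tau <= n %% gamma)%N by move: small; rewrite Dh -eh ltnn orbF => /andP[].
have DZ : {subset D <= [in z :: Z]}.
  have /eqP eD : D :&: [set y in z :: Z] == D by rewrite eqEcard subsetIl Dh hD.
  by move=> y; rewrite -eD inE => /andP[_]; rewrite inE.
have [q [gq wq sq cq]] := optimal_count_square closed_le1 gamma_gt0 h_gt0 cl_arc erefl DZ Dh op.
rewrite -wq in p1w.
have [? ? ? ?] := goodP _ gq p1w; exists q; split=> //; split; first exact: sizeA.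
have wq0 : wt B x q != 0 by apply: rmax_le_neq0 p1w wp.
have [+ _] := class_count cl_arc gamma_gt0 wq0 tau_lt.
rewrite ED => q_size; rewrite addn1 -eh gh.
apply: leq_trans q_size _; rewrite [leqRHS]addnAC -mulnDr -Wi_square // addnC leq_add //.
by rewrite leq_mul2l cq orbT.
Qed.

Lemma critical_loop_at y k : y \in z :: Z ->
  exists l, [/\ size l = (k * g)%N, last y l = y & wt B y l = 1].
Proof.
move=> yZ; have yZ' : y \in z :: rcons Z z.
  by move: yZ; rewrite !inE mem_rcons inE => /orP[->|->] //; rewrite !orbT.
have [l [sl ll wl]] : exists l, [/\ size l = g, last y l = y & wt B y l = 1].
  case/splitPl e : _ / yZ' => [u v uy]; exists (v ++ u).
  have vz : last y v = z by rewrite -uy -last_cat -e last_rcons.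
  split.
  - by rewrite size_cat addnC -size_cat -e size_rcons.
  - by rewrite last_cat vz.
  - by rewrite wt_cat vz mulrC -uy -wt_cat -e.
exists (flatten (nseq k l)); elim: k => //= k [IH1 IH2 IH3].
by rewrite size_cat last_cat wt_cat ll IH1 IH2 IH3 sl wl mulr1.
Qed.

Lemma pow_ge_walk_through_cycle x p t :
  has [in z :: Z] (x :: p) -> t = size p %[mod g] ->
  (g * (n %/ gamma) + n <= t + 2 * g)%N \/
  (gamma * Wi (n %/ gamma) + n %% gamma <= t)%N ->
  wt B x p <= (B ^+ t) x (last x p).
Proof.
move=> hZ tp tb; have [->|wp] := eqVneq (wt B x p) 0; first exact: rmax_le0x.
have [q [<- hq qp wq [bA bB]]] := bound_through_cycle hZ wp.
apply: le_trans wq _.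
have q_lt : (size q + 1 <= t + g)%N.
  case: tb => tb.
    by rewrite -(leq_add2r g) -[leqRHS]addnA addnn -mul2n (leq_trans bA).
  by apply: leq_trans bB _; rewrite leq_add2r.
have e : size q = t %[mod g] by rewrite qp tp.
(* A length congruent to [t] modulo [g] and below [t + g] is at most [t]; copies of the cycle then
   fill the gap. *)
have qt : (size q <= t)%N.
  rewrite leqNgt; apply/negP => lt.
  have gd : (g %| size q - t)%N by rewrite -eqn_mod_dvd ?(ltnW lt) // e.
  by have := dvdn_leq _ gd; rewrite subn_gt0 => /(_ lt); clear -q_lt lt; lia.
have /dvdnP[k ek] : (g %| t - size q)%N by rewrite -eqn_mod_dvd // e.
have /hasP[y yq yZ] := hq.
have [l [sl ll wl]] := critical_loop_at k yZ.
case/splitPl: yq e q_lt qt ek {hq qp bA bB} => u v uy e q_lt qt ek.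
have := wt_pow B x (u ++ l ++ v).
rewrite !size_cat sl !last_cat uy ll addnCA -size_cat -ek subnK //.
by rewrite !wt_cat uy ll wl mul1r.
Qed.

End CriticalWalks.

(** * The critical graph *)

Lemma wt_arc_path (R : realType) n (A : 'M[Rmax R]_n) x p :
  (wt A x p != 0) = path (arc A) x p.
Proof. by elim: p x => //= y p IH x; rewrite rmax_mul_eq0 negb_or IH. Qed.

Lemma wt_fpath (R : realType) n (A : 'M[Rmax R]_n) f x p : fpath f x p ->
  wt A x p = \prod_(i <- belast x p) A i (f i).
Proof.
elim: p x => [|y p IH] x /=; first by rewrite big_nil.
by move=> /andP[/eqP <- /IH ->]; rewrite big_cons.
Qed.

Lemma cycle_weight (R : realType) n (A : 'M[Rmax R]_n) x p : uniq (x :: p) ->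
  \prod_(i <- x :: p) A i (next (x :: p) i) = wt A x (rcons p x).
Proof. by move=> /cycle_next/wt_fpath ->; rewrite belast_rcons. Qed.

Lemma is_cycle_rot (T : finType) (e : rel T) c k :
  is_cycle e (rot k c) = is_cycle e c.
Proof. by rewrite /is_cycle /ucycleb rot_cycle rot_uniq -!size_eq0 size_rot. Qed.

Lemma is_cycleE (R : realType) n (A : 'M[Rmax R]_n) x p :
  is_cycle (arc A) (x :: p) = uniq (x :: p) && (wt A x (rcons p x) != 0).
Proof. by rewrite /is_cycle /ucycleb /= wt_arc_path andbC. Qed.

Lemma not_uniq_ex (T : eqType) (s : seq T) :
  ~~ uniq s -> exists y k, count_mem y s = k.+2.
Proof.
move=> nu; have [[y Hy]|H] := pselect (exists y, 1 < count_mem y s)%N.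
  by exists y, (count_mem y s).-2; lia.
case/negP: nu; apply: count_mem_uniq => x; apply/eqP.
rewrite -has_pred1 has_count; have : ~~ (1 < count_mem x s)%N.
  by apply/negP => lt; apply: H; exists x.
by case: (count_mem x s) => [|[|]].
Qed.

Section NormalizedMatrix.
Variables (R : realType) (d : nat) (A : 'M[Rmax R]_d).
Hypothesis lam_neq0 : max_cycle_mean A != 0.
Let lam := max_cycle_mean A.
(** With this scaling no cycle weighs more than 1, and the critical cycles are those of weight 1. *)
Definition normalized : 'M[Rmax R]_d := rmax_inv lam *: A.
Let N := normalized.

Lemma wt_normalized x p : wt N x p = rmax_inv lam ^+ size p * wt A x p.
Proof.
elim: p x => [|y p IH] x /=; first by rewrite mulr1.
by rewrite IH mxE exprS mulrACA.
Qed.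

Lemma normalized_neq0 x p : (wt N x p != 0) = (wt A x p != 0).
Proof.
by rewrite wt_normalized rmax_mul_eq0 negb_or rmax_expr_neq0 // rmax_inv_eq0.
Qed.

Lemma arc_normalized : arc N =2 arc A.
Proof. by move=> x y; rewrite /arc mxE rmax_mul_eq0 rmax_inv_eq0 (negPf lam_neq0). Qed.

Lemma cycle_mean_le c : is_cycle (arc A) c -> cycle_mean A c <= lam.
Proof.
move=> cc; have sc : (size c < d.+1)%N.
  case/andP: cc => _ /andP[_ /card_uniqP <-].
  by rewrite ltnS -[d in leqRHS]card_ord max_card.
pose F (k : 'I_d.+1) : Rmax R := \sum_(c : k.-tuple 'I_d | is_cycle (arc A) c) cycle_mean A c.
apply: (@le_trans _ _ (F (Ordinal sc))); last exact: (@rmax_le_sum _ _ xpredT F).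
exact: (@rmax_le_sum _ _ (fun c : (size c).-tuple 'I_d => is_cycle (arc A) c) _ (in_tuple c)).
Qed.

Lemma max_cycle_mean_attained : exists c, critical_cycle A c.
Proof.
have [k _ e] := rmax_sum_attained lam_neq0.
move: (lam_neq0); rewrite /max_cycle_mean e => /rmax_sum_attained[c cc e'].
by exists c; rewrite /critical_cycle cc /= /max_cycle_mean e e'.
Qed.

Lemma cycle_mean_normalized x p : is_cycle (arc A) (x :: p) ->
  ((wt N x (rcons p x) <= 1) = (cycle_mean A (x :: p) <= lam)) /\
  ((wt N x (rcons p x) == 1) = (cycle_mean A (x :: p) == lam)).
Proof.
rewrite is_cycleE => /andP[up w0].
rewrite /cycle_mean cycle_weight // wt_normalized size_rcons.
case: (wt A x _) w0 => [w|] // _; move: lam_neq0; rewrite /lam.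
case: (max_cycle_mean A) => [l|] // _ /=.
have -> : (Some (- l) : Rmax R) ^+ (size p).+1 = Some (- (l *+ (size p).+1)).
  elim: (size p).+1 => [|k IH]; first by rewrite expr0 mulr0n oppr0.
  by rewrite exprS IH [_ * _]/GRing.mul /= mulrS opprD.
rewrite [_ * _]/GRing.mul /= rmax_leS rmax_leS.
have s0 : 0 < (size p).+1%:R :> R by rewrite ltr0n.
split; first by rewrite addrC subr_le0 ler_pdivrMr // mulr_natr.
apply/eqP/eqP => -[e]; congr Some.
  by move/eqP: e; rewrite addrC subr_eq0 => /eqP ->; rewrite -[l *+ _]mulr_natr mulfK // gt_eqF.
by rewrite -e -[_ *+ _]mulr_natr divfK ?gt_eqF // addNr.
Qed.

Lemma cycle_normalized_le1 x p : uniq (x :: p) -> wt N x (rcons p x) <= 1.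
Proof.
move=> up; have [->|w0] := eqVneq (wt N x (rcons p x)) 0; first exact: rmax_le0x.
rewrite normalized_neq0 in w0.
have cc : is_cycle (arc A) (x :: p) by rewrite is_cycleE up.
by rewrite (cycle_mean_normalized cc).1 cycle_mean_le.
Qed.

Lemma critical_cycleE x p :
  critical_cycle A (x :: p) = uniq (x :: p) && (wt N x (rcons p x) == 1).
Proof.
rewrite /critical_cycle; have [cc|] := boolP (is_cycle (arc A) (x :: p)).
  by rewrite (cycle_mean_normalized cc).2; move: cc; rewrite is_cycleE => /andP[->].
rewrite is_cycleE; case: uniq => //=; rewrite negbK => /eqP e.
by rewrite wt_normalized e mulr0.
Qed.

(** A nonempty closed walk is a cycle or splits at a repeated node into two shorter closed walks. *)
Lemma normalized_closed_le1 x p : last x p = x -> wt N x p <= 1.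
Proof.
have [m] := ubnP (size p); elim: m p x => // m IH p x; rewrite ltnS.
case/lastP: p => [|p z]; first by rewrite /= lexx.
rewrite last_rcons size_rcons => pm ->{z}.
have [up|] := boolP (uniq (x :: p)); first exact: cycle_normalized_le1.
case/not_uniq_ex => y [k e].
have [p0 [[|l ls] [s [ep p0y lls sls]]]] := split_loops e; first by [].
move: lls => /= /andP[/andP[l0 /eqP ly] lls].
have sl : (size l + size (splice p0 ls s) = size p)%N.
  by rewrite ep /splice /= !size_cat; lia.
have l_gt0 : (0 < size l)%N by rewrite lt0n size_eq0.
have -> : wt N x (rcons p x) = wt N y l * wt N x (rcons (splice p0 ls s) x).
  by rewrite ep /splice /= -!cats1 -!catA !wt_cat p0y ly mulrCA.
apply: le_trans (rmax_leMl1 _ _) _; first by apply: IH => //; lia.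
by apply: IH; rewrite ?last_rcons // size_rcons; lia.
Qed.

Lemma shorten_walk x p : exists q, [/\ last x q = last x p, uniq (x :: q),
  wt N x p <= wt N x q & (size q <= size p)%N].
Proof.
have [m] := ubnP (size p); elim: m p => // m IH p; rewrite ltnS => pm.
have [up|] := boolP (uniq (x :: p)); first by exists p; rewrite lexx.
case/not_uniq_ex => y [k e].
have [p0 [[|l ls] [s [ep p0y lls sls]]]] := split_loops e; first by [].
move: lls => /= /andP[/andP[l0 /eqP ly] lls].
have sl : (size l + size (splice p0 ls s) = size p)%N.
  by rewrite ep /splice /= !size_cat; lia.
have l_gt0 : (0 < size l)%N by rewrite lt0n size_eq0.
have [|q [q1 q2 q3 q4]] := IH (splice p0 ls s); first by rewrite (leq_trans _ pm) // -sl -addn1 addnC leq_add2r.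
exists q; split=> //; last by rewrite (leq_trans q4) // -sl leq_addl.
  by rewrite q1 ep /splice /= !last_cat p0y ly.
apply: le_trans q3; rewrite ep /splice /= -catA !wt_cat p0y ly.
by rewrite rmax_leM // rmax_leMl1 // normalized_closed_le1.
Qed.

(** Shortening the way back does not lower the weight, and no cycle exceeds 1; so the cycle obtained
    still weighs 1. *)
Lemma critical_cycle_through x y p : last y p = x -> N x y * wt N y p = 1 ->
  exists c, [/\ critical_cycle A c, x \in c, next c x = y & (size c <= (size p).+1)%N].
Proof.
move=> px w1; have [q [qx uq wq sq]] := shorten_walk y p.
rewrite px in qx; exists (y :: q); split=> //.
- rewrite critical_cycleE uq wt_rcons qx mulrC; apply/eqP/le_anti.
  rewrite -{2}w1 rmax_leM // andbT.
  by have := @cycle_normalized_le1 y q uq; rewrite wt_rcons qx mulrC.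
- by rewrite -qx mem_last.
- rewrite next_nth -{1}qx mem_last -[X in index X]qx index_last //.
  by rewrite nth_default.
Qed.

Lemma critical_cycle_at c x : critical_cycle A c -> x \in c ->
  exists q, [/\ critical_cycle A (x :: q), path (critical_arc A) x (rcons q x),
    wt N x (rcons q x) = 1, size q = (size c).-1 & next c x = head x (rcons q x)].
Proof.
move=> cc xc; have [i q eq] := rot_to xc.
have cq : critical_cycle A (x :: q).
  move: cc; rewrite -eq /critical_cycle is_cycle_rot /cycle_mean size_rot.
  move=> /andP[cc' mc]; rewrite cc' /=.
  have uc : uniq c by case/andP: cc' => _ /andP[].
  rewrite (eq_bigr (fun i => A i (next c i))) => [|? _]; last by rewrite next_rot.
  by rewrite (perm_big c) // perm_rot.
exists q; split=> //.
- have uq : uniq (x :: q) by move: cq; rewrite critical_cycleE => /andP[].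
  apply: (@sub_in_cycle _ (mem (x :: q)) (frel (next (x :: q))) (critical_arc A) _ (x :: q)).
  - by move=> a b ain _ /= /eqP <-; apply/asboolP; exists (x :: q).
  - by apply/allP.
  - exact: cycle_next.
- by move: cq; rewrite critical_cycleE => /andP[_ /eqP].
- by rewrite -(size_rot i c) eq.
- have uc : uniq c by case/andP: cc => /andP[_ /andP[]].
  rewrite -(next_rot i uc) eq next_nth mem_head /= eqxx.
  by case: (q).
Qed.

Lemma critical_arc_return x y : critical_arc A x y ->
  exists p, [/\ last y p = x, path (critical_arc A) y p & N x y * wt N y p = 1].
Proof.
move=> /asboolP[c [cc xc ->]]; have [q [cq pq wq sq eq]] := critical_cycle_at cc xc.
rewrite eq; case: q {cq} pq wq {sq eq} => [|y' q] /= /andP[_ pq] wq.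
  by exists [::].
by exists (rcons q x); rewrite last_rcons.
Qed.

(** The arcs are undone in reverse order, each by the rest of a critical cycle through it. *)
Lemma critical_path_return x p : path (critical_arc A) x p ->
  exists q, [/\ last (last x p) q = x, path (critical_arc A) (last x p) q
               & wt N x p * wt N (last x p) q = 1].
Proof.
elim: p x => [|y p IH] x /=; first by exists [::]; rewrite mulr1.
move=> /andP[/critical_arc_return[r [ry pr wr]] /IH[q [qy pq wq]]].
exists (q ++ r); rewrite last_cat qy ry cat_path pq qy pr; split=> //.
by rewrite wt_cat qy [wt N (last y p) q * _]mulrC mulrACA wr mul1r.
Qed.

(** The walk and its return are both closed, hence weigh at most 1, and their product is 1. *)
Lemma critical_closed_wt x p : path (critical_arc A) x p -> last x p = x ->
  wt N x p = 1.
Proof.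
move=> /critical_path_return[q []] + _ + px; rewrite px => qx w1.
apply: le_anti; rewrite normalized_closed_le1 //= -w1.
by rewrite rmax_leMr1 // normalized_closed_le1.
Qed.

Lemma critical_path_neq0 x p : path (critical_arc A) x p -> wt N x p != 0.
Proof.
move=> /critical_path_return[q [_ _ w1]]; apply: contra_eq_neq w1 => ->.
by rewrite mul0r.
Qed.

Lemma connect_critical_sym x y :
  connect (critical_arc A) x y -> connect (critical_arc A) y x.
Proof.
by move=> /connectP[p /critical_path_return[q [qx pq _]] e]; apply/connectP; exists q; rewrite e.
Qed.

Lemma mem_critical_scc x y :
  (y \in scc (critical_arc A) x) = connect (critical_arc A) x y.
Proof.
by rewrite inE; apply/andP/idP => [[]//|h]; rewrite h connect_critical_sym.
Qed.

Lemma critical_scc_cycle x c : critical_cycle A c -> x \in c ->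
  cycle_length_in (critical_arc A) (scc (critical_arc A) x) (size c).
Proof.
move=> cc xc; have [q [cq pq _ sq _]] := critical_cycle_at cc xc.
have -> : size c = size (x :: q) by rewrite /= sq prednK //; case: c xc {cc sq}.
apply/existsP; exists (in_tuple (x :: q)); apply/andP; split.
  by rewrite /is_cycle /ucycleb /= pq; move: cq; rewrite critical_cycleE => /andP[].
apply/allP => y; rewrite /= mem_critical_scc => yq; apply/connectP.
have : y \in x :: rcons q x by move: yq; rewrite !inE mem_rcons inE => /orP[->|->]; rewrite ?orbT.
by case/splitPl e : _ / => [u v uy]; exists u; move: pq; rewrite ?e ?cat_path => // /andP[].
Qed.

Section Component.
Variable x : 'I_d.
Let H := scc (critical_arc A) x.

Lemma girth_in_le k : cycle_length_in (critical_arc A) H k ->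
  (girth_in (critical_arc A) H <= k)%N.
Proof.
move=> kc; have kd : (k < #|'I_d|.+1)%N.
  move/existsP: kc => [c /andP[/andP[_ /andP[_ /card_uniqP sc]] _]].
  by rewrite ltnS -(size_tuple c) -sc max_card.
rewrite /girth_in; have := mem_index_enum (Ordinal kd).
elim: (index_enum _) => // i r IH; rewrite inE big_cons => /predU1P[<-|/IH le].
  by rewrite kc geq_minl.
by case: ifP => // _; apply: leq_trans le; apply: geq_minr.
Qed.

Lemma girth_cycle : critical_node A x ->
  cycle_length_in (critical_arc A) H (girth_in (critical_arc A) H).
Proof.
move=> /asboolP[c [cc xc]]; have ck := critical_scc_cycle cc xc.
have [k kc kmin] := ex_minnP (ex_intro (cycle_length_in (critical_arc A) H) _ ck).
suff -> : girth_in (critical_arc A) H = k by [].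
apply/eqP; rewrite eqn_leq girth_in_le // /girth_in.
apply: (big_ind (fun a => k <= a)%N) => [|a b ka kb|i]; last exact: kmin.
  (* The default value of the minimum is no smaller than [k] either, as a cycle repeats no node. *)
  move/existsP: kc => [c' /andP[/andP[_ /andP[_ /card_uniqP sc]] _]].
  by rewrite -(size_tuple c') -sc max_card.
by rewrite leq_min ka kb.
Qed.

(** The lengths modulo [m] of closed critical walks at [x] form a subgroup, multiplication by [m.-1]
    giving negatives; by Bezout it contains the gcd of the cycle lengths. *)
Lemma closed_walk_residue m k : (0 < m)%N ->
  (cyclicity_in (critical_arc A) H %| k)%N ->
  exists p, [/\ path (critical_arc A) x p, last x p = x & size p = k %[mod m]].
Proof.
move=> m0; pose P k := exists p, [/\ path (critical_arc A) x p, last x p = x & size p = k %[mod m]].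
have P0 : P 0%N by exists [::].
have PD a b : P a -> P b -> P (a + b)%N.
  move=> [p [pp px ps]] [q [pq qx qs]]; exists (p ++ q).
  by rewrite cat_path last_cat px pp pq size_cat -modnDm ps qs modnDm.
have PM a c : P a -> P (c * a)%N.
  by move=> Pa; elim: c => // c IH; rewrite mulSn; apply: PD.
have Pmod a b : a = b %[mod m] -> P a -> P b.
  by move=> e [p [? ? e']]; exists p; rewrite e'.
suff Pc : P (cyclicity_in (critical_arc A) H) by move=> /dvdnP[c ->]; apply: PM.
apply: big_ind => //= [a b Pa Pb|i].
  have [->|a0] := posnP a; first by rewrite gcd0n.
  have [u _ /dvdnP[v e]] := Bezoutl b a0.
  apply: (Pmod (v * a + m.-1 * u * b)%N); last by apply: PD; apply: PM.
  rewrite -e -addnA -mulnDl; have -> : (u + m.-1 * u = m * u)%N.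
    by rewrite -{1}[u]mul1n -mulnDl add1n prednK.
  by rewrite -mulnA mulnC -modnDmr modnMl addn0.
move=> /existsP[[c /= zs] /andP[/andP[c0 /andP[zc _]] /allP zH]].
case: c zs c0 zc zH => // z s zs _ /= zc zH.
have /andP[xz zx] : connect (critical_arc A) x z && connect (critical_arc A) z x.
  by have := zH z (mem_head _ _); rewrite inE.
case/connectP: xz => p pp ep; case/connectP: zx => q pq eq.
(* A cycle elsewhere in the component is reached by a detour; the detours with and without the cycle
   differ by its length. *)
have P1 : P (size p + size q)%N.
  by exists (p ++ q); rewrite cat_path last_cat -ep pp pq -eq size_cat.
have P2 : P (size p + size q + i)%N.
  exists (p ++ rcons s z ++ q); rewrite !cat_path !last_cat -ep last_rcons pp pq zc -eq.
  by rewrite !size_cat size_rcons -(eqP zs) /= addnAC -addnA.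
apply: (Pmod (m.-1 * (size p + size q) + (size p + size q + i))%N); last first.
  by apply: PD => //; apply: PM.
rewrite addnA -{2}[(size p + _)%N]mul1n -mulnDl addn1 prednK //.
by rewrite mulnC modnMDl.
Qed.

End Component.
End NormalizedMatrix.

(** * CSR terms *)

Section CSRBounds.
Variables (R : realType) (d : nat) (A : 'M[Rmax R]_d).
Hypothesis lam_neq0 : max_cycle_mean A != 0.
Let N := normalized A.
Let sigma := critical_cyclicity A.

Lemma cyclicity_dvdn (T : finType) (e : rel T) (B : {set T}) k :
  cycle_length_in e B k -> (cyclicity_in e B %| k)%N.
Proof.
move=> kc; have kd : (k < #|T|.+1)%N.
  move/existsP: kc => [c /andP[/andP[_ /andP[_ /card_uniqP sc]] _]].
  by rewrite ltnS -(size_tuple c) -sc max_card.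
exact: (biggcdn_inf (Ordinal kd)).
Qed.

Lemma cyclicity_gt0 x : critical_node A x ->
  (0 < cyclicity_in (critical_arc A) (scc (critical_arc A) x))%N.
Proof.
move=> /(girth_cycle lam_neq0) gc; apply: dvdn_gt0 (cyclicity_dvdn gc).
by case/existsP: gc => [[c /= /eqP <-] /andP[/andP[+ _] _]]; case: c.
Qed.

Lemma critical_cyclicity_gt0 : (0 < sigma)%N.
Proof.
apply: (big_ind (fun k => 0 < k)%N) => // [a b|B]; first by rewrite lcmn_gt0 => -> ->.
by case/imsetP => x xc ->; apply: cyclicity_gt0.
Qed.

Lemma cyclicity_dvdn_critical x : critical_node A x ->
  (cyclicity_in (critical_arc A) (scc (critical_arc A) x) %| sigma)%N.
Proof.
move=> xc; apply: (@biglcmn_sup _ (scc (critical_arc A) x)) => //.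
exact: imset_f.
Qed.

Lemma girth_le_max x : critical_node A x ->
  (girth_in (critical_arc A) (scc (critical_arc A) x) <= max_critical_girth A)%N.
Proof. by move=> xc; apply: leq_bigmax_cond; apply: imset_f. Qed.

Lemma max_critical_girth_attained : exists2 x, critical_node A x &
  max_critical_girth A = girth_in (critical_arc A) (scc (critical_arc A) x).
Proof.
have [c cc] := max_cycle_mean_attained lam_neq0.
have [x xc] : exists x, critical_node A x.
  case: c cc => [|x c] cc; first by case/andP: cc => /andP[].
  by exists x; apply/asboolP; exists (x :: c); rewrite mem_head.
have c0 : (0 < #|[in critical_components A]|)%N.
  by apply/card_gt0P; exists (scc (critical_arc A) x); apply: imset_f.
have [B + e] := eq_bigmax_cond (girth_in (critical_arc A)) c0.
by case/imsetP => y yc eB; exists y; rewrite // /max_critical_girth e eB.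
Qed.

Lemma expmxZ t : A ^+ t = max_cycle_mean A ^+ t *: N ^+ t.
Proof.
have eA : A = max_cycle_mean A *: N.
  by rewrite scalerA mulrC rmax_mulVx // scale1r.
elim: t => [|t IH]; first by rewrite !expr0 scale1r.
rewrite !exprS {1}IH {1}eA -[LHS]/(_ *m _) -scalemxAl -scalemxAr scalerA.
by [].
Qed.

(** Every walk is dominated by one without repetition, hence of length below [d]. This makes the
    suprema in [csr_M] genuine. *)
Lemma normalized_pow_bounded x y : exists z, forall k, (N ^+ k) x y <= z.
Proof.
exists (\sum_(k < d) (N ^+ k) x y) => k.
have [->|n0] := eqVneq ((N ^+ k) x y) 0; first exact: rmax_le0x.
have [p [_ <- <-]] := pow_wt n0.
have [q [<- uq wq _]] := shorten_walk lam_neq0 x p; apply: le_trans wq _.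
have qd : (size q < d)%N.
  by rewrite -[(size q).+1]/(size (x :: q)) -(card_uniqP uq) -[d in leqRHS]card_ord max_card.
apply: le_trans (wt_pow N x q) _.
exact: (@rmax_le_sum _ _ xpredT (fun k : 'I_d => (N ^+ k) x (last x q)) (Ordinal qd)).
Qed.

Lemma csr_M_ge x y k : (N ^+ (sigma * k)) x y <= csr_M A x y.
Proof.
have [z zP] := normalized_pow_bounded x y.
rewrite /csr_M /kleene_star mxE; apply: (@rmax_sup_ub _ _ z); last by exists k; rewrite exprM.
by move=> _ [m ->]; rewrite -exprM.
Qed.

(** A finite [u] is invertible and can be moved to the other side of the inequality, under the
    supremum. *)
Lemma csr_M_mul_le x y u v :
  (forall k, (N ^+ (sigma * k)) x y * u <= v) -> csr_M A x y * u <= v.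
Proof.
move=> H; have [->|u0] := eqVneq u 0; first by rewrite mulr0; exact: rmax_le0x.
have E w : (w * u <= v) = (w <= rmax_inv u * v).
  rewrite -(rmax_leM2l (z := rmax_inv u)) ?rmax_inv_eq0 //.
  by rewrite mulrCA rmax_mulVx ?mulr1.
rewrite E /csr_M /kleene_star mxE; apply: rmax_sup_le => _ [k ->].
by rewrite -exprM -E.
Qed.

Lemma wt_critical_S x p : path (critical_arc A) x p ->
  wt (csr_S A) x p = wt N x p.
Proof.
elim: p x => //= y p IH x /andP[xy /IH ->].
by rewrite /csr_S mxE xy /N /normalized mxE.
Qed.

Lemma wt_S_neq0 x p : wt (csr_S A) x p != 0 ->
  path (critical_arc A) x p.
Proof.
elim: p x => //= y p IH x; rewrite rmax_mul_eq0 negb_or => /andP[+ /IH ->].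
by rewrite /csr_S mxE andbT; case: ifP => //; rewrite eqxx.
Qed.

(** Copies of a critical cycle are inserted at the critical node at no cost, and the walk is cut
    anew: outer parts of length divisible by [sigma], bounded by [csr_C] and [csr_R], around a
    critical part of length [t]. *)
Lemma csr_ge x u v : critical_node A (last x u) ->
  wt N x (u ++ v) <= CSR A (size u + size v) x (last x (u ++ v)).
Proof.
move=> /asboolP[c [cc kc]]; set k := last x u in kc *.
have [q [cq pq wq _ _]] := critical_cycle_at lam_neq0 cc kc.
set l := rcons q k in pq wq; pose len := size l.
set a := size u; set b := size v; set t := (a + b)%N.
pose big := flatten (nseq (t * sigma) l).
have [bs bw bp bl bk] : [/\ size big = (t * sigma * len)%N, wt N k big = 1,
    path (critical_arc A) k big, last k big = k & {subset k :: big <= k :: q}].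
  rewrite /big; elim: (t * sigma)%N => [|m [IH1 IH2 IH3 IH4 IH5]] /=.
    by split=> // y; rewrite !inE => ->.
  rewrite size_cat wt_cat cat_path last_cat last_rcons IH1 IH2 IH4 wq mul1r pq IH3.
  split=> // y; rewrite inE mem_cat mem_rcons inE -orbA => /or4P[/eqP->|/eqP->|yq|ym].
  - by rewrite eqxx.
  - by rewrite eqxx.
  - by rewrite yq orbT.
  - by have := IH5 y; rewrite !inE ym orbT; apply.
have ls_gt0 : (0 < len * sigma)%N by rewrite /len size_rcons muln_gt0 critical_cyclicity_gt0.
(* These complete the lengths of [u] and [v] to multiples of [len * sigma], and [a' + t + b'] is the
   length of [big]. *)
pose a' := (a * (len * sigma).-1)%N; pose b' := (b * (len * sigma).-1)%N.
have aa : (a + a' = a * (len * sigma))%N by rewrite -mulnS prednK.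
have bb : (b' + b = b * (len * sigma))%N by rewrite addnC -mulnS prednK.
pose w1 := take a' big; pose w2 := take t (drop a' big); pose w3 := drop t (drop a' big).
have ew : big = w1 ++ w2 ++ w3 by rewrite !cat_take_drop.
have s1 : size w1 = a'.
  by rewrite size_takel // bs -mulnA [(sigma * _)%N]mulnC mulnDl -aa -bb; lia.
have s2 : size w2 = t.
  by rewrite size_takel // size_drop bs -mulnA [(sigma * _)%N]mulnC mulnDl -aa -bb /t; lia.
have s3 : size w3 = b'.
  by rewrite !size_drop bs -mulnA [(sigma * _)%N]mulnC mulnDl -aa -bb /t; lia.
pose c1 := last k w1; pose c2 := last c1 w2.
have node y : y \in k :: big -> critical_node A y.
  by move=> /bk yq; apply/asboolP; exists (k :: q).
have c1c : critical_node A c1.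
  by apply: node; rewrite ew -cat_cons mem_cat /c1 mem_last.
have c2c : critical_node A c2.
  by apply: node; rewrite ew catA -cat_cons mem_cat /c2 /c1 -last_cat mem_last.
have c3 : last c2 w3 = k by rewrite -bl ew !last_cat.
move: bp; rewrite ew !cat_path -/c1 => /and3P[_ p2 _].
have H1 : wt N x (u ++ w1) <= csr_C A x c1.
  rewrite /csr_C mxE c1c; apply: le_trans (csr_M_ge x c1 (a * len)).
  have := wt_pow N x (u ++ w1); rewrite size_cat s1 aa last_cat -/k -/c1.
  by rewrite mulnA [(sigma * _)%N]mulnC.
have H2 : wt N c1 w2 <= (csr_S A ^+ t) c1 c2.
  by rewrite -wt_critical_S // -s2; apply: wt_pow.
have H3 : wt N c2 (w3 ++ v) <= csr_R A c2 (last x (u ++ v)).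
  rewrite /csr_R mxE c2c; apply: le_trans (csr_M_ge c2 _ (b * len)).
  have := wt_pow N c2 (w3 ++ v); rewrite size_cat s3 bb !last_cat c3 -/k.
  by rewrite mulnA [(sigma * _)%N]mulnC.
have -> : wt N x (u ++ v) = wt N x (u ++ w1) * wt N c1 w2 * wt N c2 (w3 ++ v).
  move: bw; rewrite ew !wt_cat -/k -/c1 -/c2 c3 => bw.
  by rewrite -[in LHS](mulr1 (wt N x u)) -[in LHS]bw -!mulrA.
rewrite /CSR mxE; apply: le_trans (rmax_leM (rmax_leM H1 H2) H3) _.
apply: (@le_trans _ _ ((csr_C A *m csr_S A ^+ t) x c2 * csr_R A c2 (last x (u ++ v)))).
  apply: rmax_leM (lexx _); rewrite [X in _ <= X]mxE.
  exact: (@rmax_le_sum _ _ xpredT (fun y => csr_C A x y * (csr_S A ^+ t) y c2) c1).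
exact: (@rmax_le_sum _ _ xpredT (fun y => (csr_C A *m csr_S A ^+ t) x y * csr_R A y _)).
Qed.

(** An entry of the product is a supremum over walks in three parts: the outer ones have length
    divisible by [sigma], the inner one is critical of length [t]. *)
Lemma csr_le t x y z :
  (forall p q, critical_node A (last x p) -> last x (p ++ q) = y ->
     (exists k, size (p ++ q) = t + sigma * k)%N -> wt N x (p ++ q) <= z) ->
  CSR A t x y <= z.
Proof.
move=> H; rewrite /CSR mxE; apply: rmax_sum_le => c2 _; rewrite mxE big_distrl.
apply: rmax_sum_le => c1 _ /=; rewrite [csr_C A x c1]mxE [csr_R A c2 y]mxE.
case c1c : (critical_node A c1); last by rewrite !mul0r; exact: rmax_le0x.
case: (critical_node A c2); last by rewrite mulr0; exact: rmax_le0x.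
rewrite -mulrA; apply: csr_M_mul_le => k1; rewrite mulrA mulrC; apply: csr_M_mul_le => k2.
have [->|] := eqVneq ((N ^+ (sigma * k2)) c2 y * ((N ^+ (sigma * k1)) x c1 * (csr_S A ^+ t) c1 c2)) 0.
  exact: rmax_le0x.
rewrite !rmax_mul_eq0 !negb_or => /and3P[/pow_wt[p3 [s3 l3 <-]] /pow_wt[p1 [s1 l1 <-]] n2].
have [p2 [s2 l2 e2]] := pow_wt n2; rewrite -e2 in n2 *.
rewrite wt_critical_S ?wt_S_neq0 //.
have <- : wt N x (p1 ++ p2 ++ p3) = wt N c2 p3 * (wt N x p1 * wt N c1 p2).
  by rewrite !wt_cat l1 l2 mulrA mulrC.
apply: H; rewrite ?last_cat ?l1 ?l2 //.
by exists (k1 + k2)%N; rewrite !size_cat s1 s2 s3 mulnDr addnCA.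
Qed.

Lemma nachtigall_le t x y : (nachtigall A ^+ t) x y <= (A ^+ t) x y.
Proof.
have [->|n0] := eqVneq ((nachtigall A ^+ t) x y) 0; first exact: rmax_le0x.
have [p [<- <- <-]] := pow_wt n0; apply: le_trans (wt_pow A x p).
elim: p x {n0} => //= z p IH x; rewrite rmax_leM // mxE.
by case: ifP => // _; exact: rmax_le0x.
Qed.

Lemma wt_nachtigall x p : ~~ has (critical_node A) (x :: p) ->
  wt (nachtigall A) x p = wt A x p.
Proof.
elim: p x => // y p IH x H.
have /norP[xc H'] : ~~ (critical_node A x || has (critical_node A) (y :: p)) := H.
have /norP[yc _] : ~~ (critical_node A y || has (critical_node A) p) := H'.
by rewrite /= (IH y H') mxE (negPf xc) (negPf yc).
Qed.

Lemma pow_le_csr t x y :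
  (A ^+ t) x y <= (max_cycle_mean A ^+ t *: CSR A t + nachtigall A ^+ t) x y.
Proof.
case: t => [|t]; first by rewrite !expr0 [X in _ <= X]mxE addrC rmax_lexD.
have [->|n0] := eqVneq ((A ^+ t.+1) x y) 0; first exact: rmax_le0x.
have [p [sp lp wp]] := pow_wt n0; rewrite mxE.
have [/hasP[k kp kc]|nc] := boolP (has (critical_node A) (x :: p)); last first.
  rewrite addrC; apply: le_trans (rmax_lexD _ _).
  by rewrite -wp -wt_nachtigall // -sp -lp wt_pow.
apply: le_trans (rmax_lexD _ _).
rewrite expmxZ [X in X <= _]mxE [X in _ <= X]mxE rmax_leM2l ?rmax_expr_neq0 //.
case/splitPl e : _ / kp sp lp wp => [u v uk] sp lp wp.
have := @csr_ge x u v; rewrite uk => /(_ kc); rewrite -size_cat sp lp.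
suff -> : (N ^+ t.+1) x y = wt N x (u ++ v) by [].
have := wt_normalized A x (u ++ v); rewrite wp sp expmxZ mxE mulrA -exprMn.
by rewrite rmax_mulVx // expr1n mul1r.
Qed.

Lemma weak_csr_from_le T :
  (forall t x y, (T <= t)%N -> CSR A t x y <= (N ^+ t) x y) -> weak_csr_from A T.
Proof.
move=> H t /H Ht; apply/matrixP => x y; apply: le_anti; rewrite pow_le_csr /=.
rewrite mxE rmax_leDx nachtigall_le andbT [X in X <= _]mxE.
by rewrite expmxZ [X in _ <= X]mxE rmax_leM.
Qed.
End CSRBounds.

(** * Lifting walks along a factorization *)

Lemma pairmap_memP (S : Type) (T : eqType) (f : S -> S -> T) x p k :
  k \in pairmap f x p -> exists u y v, p = u ++ y :: v /\ k = f (last x u) y.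
Proof.
elim: p x => // y p IH x; rewrite /= inE => /predU1P[->|/IH[u [z [v [-> ->]]]]].
  by exists [::], y, p.
by exists (y :: u), z, v.
Qed.

Lemma pairmap_not_uniq (S : Type) (T : eqType) (f : S -> S -> T) x p :
  ~~ uniq (pairmap f x p) -> exists u y v z s,
    p = u ++ y :: v ++ z :: s /\ f (last x u) y = f (last y v) z.
Proof.
elim: p x => // y p IH x; rewrite /= negb_and negbK.
move=> /orP[H|H].
  by have [v [z [s [-> e]]]] := pairmap_memP H; exists [::], y, v, z, s.
by have [u [y' [v [z [s [-> e]]]]]] := IH _ H; exists (y :: u), y', v, z, s.
Qed.

Lemma pairmap_cat (S T : Type) (f : S -> S -> T) x p q :
  pairmap f x (p ++ q) = pairmap f x p ++ pairmap f (last x p) q.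
Proof. by elim: p x => //= y p IH x; rewrite IH. Qed.

Section FactorLift.
Variables (R : realType) (d r : nat) (U : 'M[Rmax R]_(d, r)) (L : 'M[Rmax R]_(r, d)).
Let N := U *m L.
Let B := L *m U.

Lemma factor_le x k y : U x k * L k y <= N x y.
Proof.
rewrite mxE; exact: (@rmax_le_sum _ _ xpredT (fun k => U x k * L k y)).
Qed.

Lemma cofactor_le k x l : L k x * U x l <= B k l.
Proof.
rewrite mxE; exact: (@rmax_le_sum _ _ xpredT (fun x => L k x * U x l)).
Qed.

Lemma factor_pow t : N ^+ t.+1 = U *m B ^+ t *m L.
Proof.
elim: t => [|t IH]; first by rewrite expr1 expr0 mulmx1.
rewrite exprSr IH [B ^+ t.+1]exprSr -[LHS]/(_ *m _) -[B ^+ t * B]/(_ *m _) /N /B.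
by rewrite !mulmxA.
Qed.

Hypothesis N_closed_le1 : forall x p, last x p = x -> wt N x p <= 1.

(** Regrouping the factors turns a closed walk of [B] into one of [N]: the last [U] and the first
    [L] meet at [k] and are bounded by an arc of [N]. *)
Lemma cofactor_closed_le1 k p : last k p = k -> wt B k p <= 1.
Proof.
case: p => [|l p]; first by rewrite /= lexx.
move=> lp; apply: le_trans (wt_pow B k (l :: p)) _; rewrite lp [size _]/=.
have [->|n0] := eqVneq ((B ^+ (size p).+1) k k) 0; first exact: rmax_le0x.
have Bpow t : B ^+ t.+1 = L *m N ^+ t *m U.
  elim: t => [|t IH]; first by rewrite expr1 expr0 mulmx1.
  rewrite exprSr IH [N ^+ t.+1]exprSr -[LHS]/(_ *m _) -[N ^+ t * N]/(_ *m _) /N /B.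
  by rewrite !mulmxA.
rewrite Bpow mxE; apply: rmax_sum_le => y _; rewrite mxE big_distrl.
apply: rmax_sum_le => x _ /=; rewrite mulrC mulrA.
apply: le_trans (rmax_leM (factor_le y k x) (lexx _)) _.
have [->|nxy] := eqVneq ((N ^+ size p) x y) 0; first by rewrite mulr0; exact: rmax_le0x.
have [q [_ <- <-]] := pow_wt nxy.
by have := @N_closed_le1 (last x q) (x :: q) erefl.
Qed.

Variable kappa : 'I_d -> 'I_d -> 'I_r.
Hypothesis kappaP : forall x y, N x y != 0 -> N x y = U x (kappa x y) * L (kappa x y) y.

(** [kappa x y] is an index realizing the arc from [x] to [y]; arcs of the walk become nodes of its
    lift, listed by [pairmap]. Regrouping can only raise the weight, by [cofactor_le]. *)
Lemma wt_lift x y p : wt N x (y :: p) <=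
  U x (kappa x y) * wt B (kappa x y) (pairmap kappa y p)
    * L (last (kappa x y) (pairmap kappa y p)) (last y p).
Proof.
elim: p x y => [|z p IH] x y; have [e|n0] := eqVneq (N x y) 0.
- by rewrite /= e mul0r; exact: rmax_le0x.
- by rewrite /= !mulr1 -kappaP.
- by rewrite [wt _ _ _]/= e mul0r; exact: rmax_le0x.
rewrite [X in X <= _]/= (kappaP n0).
apply: le_trans (rmax_leM (lexx _) (IH y z)) _ => /=.
set k := kappa x y; set l := kappa y z; rewrite -!mulrA rmax_leM //.
by rewrite !mulrA !rmax_leM // cofactor_le.
Qed.

Lemma lift_cycle z y s : last y s = z -> wt N z (y :: s) = 1 ->
  wt B (kappa z y) (rcons (pairmap kappa y s) (kappa z y)) = 1.
Proof.
move=> sz w1; apply: le_anti; rewrite cofactor_closed_le1 ?last_rcons //=.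
have n0 : N z y != 0.
  have : wt N z (y :: s) != 0 by rewrite w1.
  by rewrite /= rmax_mul_eq0 negb_or => /andP[].
(* The cycle is prolonged by its first arc to make the lift closed; this arc then cancels on both
   sides. *)
have := wt_lift z y (rcons s y).
rewrite -rcons_cons wt_rcons w1 [last _ (_ :: _)]/= sz mul1r last_rcons.
rewrite -cats1 pairmap_cat /= sz cats1 last_rcons.
by rewrite mulrAC -kappaP // -{1}[N z y]mulr1 rmax_leM2l.
Qed.

End FactorLift.

Lemma factor_entry_le (R : realType) m n q o (U : 'M[Rmax R]_(m, n))
    (M : 'M_(n, q)) (L : 'M_(q, o)) x k l y :
  U x k * M k l * L l y <= (U *m M *m L) x y.
Proof.
apply: (@le_trans _ _ ((U *m M) x l * L l y)).
  apply: rmax_leM (lexx _); rewrite [X in _ <= X]mxE.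
  exact: (@rmax_le_sum _ _ xpredT (fun k => U x k * M k l)).
rewrite [X in _ <= X]mxE.
exact: (@rmax_le_sum _ _ xpredT (fun l => (U *m M) x l * L l y)).
Qed.

(** Disables the indices that occur in no arc of the product, without changing the inner dimension,
    so that the others can be given a cyclic class. *)
Lemma trim_factorization (R : realType) m n r (U : 'M[Rmax R]_(m, r)) (L : 'M_(r, n)) :
  exists (U' : 'M[Rmax R]_(m, r)) (L' : 'M[Rmax R]_(r, n)),
    [/\ U *m L = U' *m L',
        (forall x k, U' x k != 0 -> exists y, L' k y != 0) &
        (forall k y, L' k y != 0 -> exists x, U' x k != 0)].
Proof.
pose live k := [exists x, U x k != 0] && [exists y, L k y != 0].
exists (\matrix_(x, k) if live k then U x k else 0).
exists (\matrix_(k, y) if live k then L k y else 0); split.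
- apply/matrixP => x y; rewrite !mxE; apply: eq_bigr => k _; rewrite !mxE.
  case: ifP => //; rewrite mul0r /live; apply: contraFeq.
  rewrite rmax_mul_eq0 negb_or => /andP[Ux Ly].
  by apply/andP; split; apply/existsP; [exists x | exists y].
- move=> x k; rewrite mxE; case: ifP => [lk _|]; last by rewrite eqxx.
  by have /andP[_ /existsP[y Ly]] := lk; exists y; rewrite mxE lk.
- move=> k y; rewrite mxE; case: ifP => [lk _|]; last by rewrite eqxx.
  by have /andP[/existsP[x Ux] _] := lk; exists x; rewrite mxE lk.
Qed.

(** The class of [k] is that of any [x] with [U x k] finite: all such [x] have a common successor,
    hence the same class. Indices without such [x] have no arcs and get the value 0. *)
Lemma cofactor_class (R : realType) d r (U : 'M[Rmax R]_(d, r)) (L : 'M_(r, d))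
    gamma (cl : 'I_d -> nat) :
  (forall x k, U x k != 0 -> exists y, L k y != 0) ->
  (forall k y, L k y != 0 -> exists x, U x k != 0) ->
  (forall x y, (U *m L) x y != 0 -> cl y = (cl x).+1 %[mod gamma]) ->
  exists cl', forall k l, (L *m U) k l != 0 -> cl' l = (cl' k).+1 %[mod gamma].
Proof.
move=> UL LU clP; pose cl' k := if [pick x | U x k != 0] is Some x then cl x else 0%N.
have N0 x k y : U x k != 0 -> L k y != 0 -> (U *m L) x y != 0.
  move=> u l; apply: rmax_le_neq0 (factor_le U L x k y) _.
  by rewrite rmax_mul_eq0 negb_or u.
exists cl' => k l; rewrite mxE => n0; have [x _ e] := rmax_sum_attained n0.
move: n0; rewrite e rmax_mul_eq0 negb_or => /andP[Lkx Uxl].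
have [y Lly] := UL _ _ Uxl; have [x' Ux'k] := LU _ _ Lkx.
rewrite /cl'; case: pickP => [x1 U1|/(_ x)]; last by rewrite Uxl.
case: pickP => [x2 U2|/(_ x')]; last by rewrite Ux'k.
have := clP _ _ (N0 _ _ _ U1 Lly); rewrite (clP _ _ (N0 _ _ _ Uxl Lly)).
move=> /eqP; rewrite -addn1 -[(cl x1).+1]addn1 eqn_modDr => /eqP <-.
exact: clP (N0 _ _ _ U2 Lkx).
Qed.

(** * Critical walks compared with powers of a factorized matrix *)

Section Transient.
Variables (R : realType) (d r : nat) (A : 'M[Rmax R]_d).
Hypothesis lam_neq0 : max_cycle_mean A != 0.
Hypothesis A_factorizes : factorizes A r.
Variables (gamma : nat) (cl : 'I_d -> nat).
Hypothesis gamma_gt0 : (0 < gamma)%N.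
Hypothesis cl_arc : forall x y, arc A x y -> cl y = (cl x).+1 %[mod gamma].
Let N := normalized A.
Let girth x := girth_in (critical_arc A) (scc (critical_arc A) x).

Lemma critical_scc_eq x y : y \in scc (critical_arc A) x ->
  scc (critical_arc A) y = scc (critical_arc A) x.
Proof.
rewrite mem_critical_scc // => xy; apply/setP => w; rewrite !mem_critical_scc //.
by apply/idP/idP; apply: connect_trans => //; apply: connect_critical_sym.
Qed.

(* If an element of the factorization were used twice along the cycle, exchanging
   the two arcs would cut it into shorter critical closed walks. *)
Lemma girth_lift_uniq (U : 'M[Rmax R]_(d, r)) (L : 'M_(r, d)) kappa x z p :
  N = U *m L ->
  (forall x y, N x y != 0 -> N x y = U x (kappa x y) * L (kappa x y) y) ->
  z \in scc (critical_arc A) x -> path (critical_arc A) z p -> last z p = z ->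
  size p = girth x -> uniq (pairmap kappa z p).
Proof.
move=> eN kP zH pp pz sp; apply/negPn/negP => nu.
have [u [y1 [v [y2 [s [ep ek]]]]]] := pairmap_not_uniq nu.
move: pp pz sp (critical_closed_wt lam_neq0 pp pz) (critical_path_neq0 lam_neq0 pp).
rewrite ep; set x1 := last z u in ek *; set x2 := last y1 v in ek *.
rewrite cat_path => /andP[pu _]; rewrite !last_cat /= last_cat /= => pz.
rewrite size_cat /= size_cat /= => sp.
rewrite !wt_cat /= wt_cat -/x1 -/x2 /= => w1 n1.
have : N x1 y1 != 0 /\ N x2 y2 != 0.
  by move: n1; rewrite !rmax_mul_eq0 !negb_or => /and5P[_ ? _ ? _].
move=> [/kP e1 /kP e2]; rewrite -/N e1 e2 -ek in w1.
set k := kappa x1 y1 in ek e1 e2 w1.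
have FL x' l y' : U x' l * L l y' <= N x' y' by rewrite eN factor_le.
have le_a : N x1 y2 * wt N y2 (s ++ u) <= 1.
  apply: (@normalized_closed_le1 _ _ _ lam_neq0 x1 (y2 :: s ++ u)).
  by rewrite /= last_cat /= pz.
have le_b : N x2 y1 * wt N y1 v <= 1.
  exact: (@normalized_closed_le1 _ _ _ lam_neq0 x2 (y1 :: v)).
(* Exchanging the heads of two arcs with the same index [k] only regroups their factors, so the two
   closed walks jointly weigh at least 1. *)
have ge_ab : (1 : Rmax R) <= N x1 y2 * wt N y2 (s ++ u) * (N x2 y1 * wt N y1 v).
  rewrite -w1 wt_cat pz.
  apply: (@le_trans _ _ (U x1 k * L k y2 * (wt N y2 s * wt N z u) * (U x2 k * L k y1 * wt N y1 v))).
    by rewrite [X in X <= _](AC (1*(2*(1*(2*1)))) (2*6*(7*1)*(5*3*4))) /= lexx.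
  by rewrite !rmax_leM // FL.
have a1 : N x1 y2 * wt N y2 (s ++ u) = 1.
  apply: le_anti; rewrite le_a /=; apply: le_trans ge_ab _.
  by rewrite rmax_leMr1.
have [||c [cc xc _ sc]] := @critical_cycle_through _ _ _ lam_neq0 x1 y2 (s ++ u) => //.
  by rewrite last_cat pz.
have := girth_in_le (critical_scc_cycle lam_neq0 cc xc).
rewrite (_ : scc _ x1 = scc (critical_arc A) x); last first.
  rewrite -(critical_scc_eq zH); apply: critical_scc_eq.
  by rewrite mem_critical_scc //; apply/connectP; exists u.
rewrite -/(girth x) -sp => le; have := leq_trans le sc.
by rewrite size_cat; clear; lia.
Qed.

(** A critical closed walk through a shortest cycle of the component; inserted into a walk counted
    by the CSR term, it removes the excess [critical_cyclicity A * k] modulo the girth. *)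
Lemma critical_insertion x k : critical_node A x ->
  exists z y s, [/\ z \in scc (critical_arc A) x,
    path (critical_arc A) z (y :: s), last y s = z, (size s).+1 = girth x &
    exists a b, [/\ last x a = z, path (critical_arc A) x (a ++ (y :: s) ++ b),
      last x (a ++ (y :: s) ++ b) = x &
      (girth x %| size (a ++ (y :: s) ++ b) + critical_cyclicity A * k)%N]].
Proof.
move=> xc; have /existsP[[c /= sc] /andP[/andP[c0 /andP[cc _]] /allP cH]] := girth_cycle lam_neq0 xc.
case: c sc c0 cc cH => // z c /eqP sc _ /= cc cH.
have zH : z \in scc (critical_arc A) x by apply: cH; exact: mem_head.
have [y [s e]] : exists y s, rcons c z = y :: s.
  by case: (c) => [|y c']; [exists z, [::] | exists y, (rcons c' z)].
rewrite e in cc.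
have sz : last y s = z by rewrite -[last y s]/(last z (y :: s)) -e last_rcons.
have ss : (size s).+1 = girth x.
  by rewrite -[(size s).+1]/(size (y :: s)) -e size_rcons.
have g0 : (0 < girth x)%N by rewrite -ss.
exists z, y, s; split=> //.
have := zH; rewrite mem_critical_scc // => /connectP[a pa ea].
have /connectP[b pb eb] : connect (critical_arc A) z x.
  by move: zH; rewrite inE => /andP[].
pose D := a ++ (y :: s) ++ b.
have pD : path (critical_arc A) x D by rewrite !cat_path pa -ea cc /= sz pb.
have lD : last x D = x by rewrite !last_cat -ea /= sz.
pose Dg m := flatten (nseq m D).
have DgP m : [/\ path (critical_arc A) x (Dg m), last x (Dg m) = x & size (Dg m) = (m * size D)%N].
  elim: m => // m [IH1 IH2 IH3].
  by rewrite /Dg /= cat_path last_cat size_cat pD lD IH1 IH2 IH3.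
(* With the leading [D] this makes [girth x] copies, of total length divisible by the girth; the
   residue is left to [w]. *)
have [Dp Dl Ds] := DgP (girth x).-1.
have [|w [pw lw sw]] := @closed_walk_residue _ _ A x (girth x) ((girth x).-1 * (critical_cyclicity A * k))%N g0.
  by rewrite dvdn_mull // dvdn_mulr // cyclicity_dvdn_critical.
exists a, (b ++ Dg (girth x).-1 ++ w).
have -> : a ++ (y :: s) ++ b ++ Dg (girth x).-1 ++ w = D ++ Dg (girth x).-1 ++ w.
  by rewrite /D -!catA.
split=> //; first by rewrite cat_path pD lD cat_path Dp Dl.
  by rewrite last_cat lD last_cat Dl.
rewrite size_cat [size (Dg _ ++ w)]size_cat Ds [(size D + _)%N]addnA -mulSn prednK //.
rewrite -addnA dvdn_addr ?dvdn_mulr // /dvdn -modnDml sw modnDml addnC -mulSn prednK //.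
by rewrite modnMr.
Qed.

(* The lift of a walk has one arc less than the walk, whence [t.+1] against [t]
   and the summand 1 in the four bounds. *)
Lemma pow_ge_critical_walk x p q : critical_node A (last x p) ->
  [/\ (gamma %| girth (last x p))%N, (girth (last x p) <= r)%N &
   forall t k, size (p ++ q) = (t.+1 + critical_cyclicity A * k)%N ->
   (girth (last x p) * (r %/ gamma) + r <= t + 2 * girth (last x p))%N \/
   (gamma * Wi (r %/ gamma) + r %% gamma <= t)%N ->
   wt N x (p ++ q) <= (N ^+ t.+1) x (last x (p ++ q))].
Proof.
move=> xc; set c := last x p in xc *.
have [U0 [L0 eA]] := A_factorizes.
have [U [L [eUL UL LU]]] := trim_factorization (rmax_inv (max_cycle_mean A) *: U0) L0.
have eN : N = U *m L by rewrite -eUL -scalemxAl -eA.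
have clN x' y' : (U *m L) x' y' != 0 -> cl y' = (cl x').+1 %[mod gamma].
  by move=> h; apply: cl_arc; rewrite -arc_normalized // /arc -/N eN.
have [clB clBP] := cofactor_class UL LU clN.
have closed_le1 x' p' : last x' p' = x' -> wt (U *m L) x' p' <= 1.
  by rewrite -eN; apply: normalized_closed_le1.
have closedB := cofactor_closed_le1 closed_le1.
have ins k := critical_insertion k xc.
(* [N] has a critical arc, so [r] is positive; [k0] is the default value of [kappa]. *)
have [k0 _] : exists k0 : 'I_r, True.
  have [z [y [s [_ /andP[zy _] _ _ _]]]] := ins 0%N.
  have : N z y != 0.
    have := @critical_path_neq0 _ _ _ lam_neq0 z [:: y]; rewrite /= zy => /(_ isT).
    by rewrite mulr1.
  by rewrite eN mxE => /rmax_sum_attained[k0 _ _]; exists k0.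
pose kappa x' y' := odflt k0 [pick k | N x' y' == U x' k * L k y'].
have kP x' y' : N x' y' != 0 -> N x' y' = U x' (kappa x' y') * L (kappa x' y') y'.
  rewrite /kappa; case: pickP => [k /eqP //|H]; rewrite eN mxE => n0.
  have [k _ e] := rmax_sum_attained n0.
  by have := H k; rewrite eN mxE e eqxx.
have kP' := kP; rewrite eN in kP'.
have lift k : exists z y s a b, [/\ uniq (kappa z y :: pairmap kappa y s),
    wt (L *m U) (kappa z y) (rcons (pairmap kappa y s) (kappa z y)) = 1,
    (size s).+1 = girth c &
    [/\ last c a = z, wt N c (a ++ (y :: s) ++ b) = 1, last c (a ++ (y :: s) ++ b) = c &
      (girth c %| size (a ++ (y :: s) ++ b) + critical_cyclicity A * k)%N]].
  have [z [y [s [zH pzy sz ss [a [b [az pab lab dab]]]]]]] := ins k.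
  exists z, y, s, a, b; split=> //.
  - have := girth_lift_uniq eN kP zH pzy; rewrite [last _ _]/= [size _]/= => H.
    by have := H sz ss.
  - apply: lift_cycle => //.
    by rewrite -eN; apply: (critical_closed_wt lam_neq0 pzy).
  - split=> //; exact: critical_closed_wt.
have [z [y [s [_ [_ [Zu Zw ss _]]]]]] := lift 0%N.
have sg : size (kappa z y :: pairmap kappa y s) = girth c by rewrite /= size_pairmap ss.
split.
- by rewrite -sg; apply: (cycle_length_dvdn clBP Zw).
- by rewrite -sg; apply: (cycle_length_le Zu).
move=> t k st tb {z y s Zu Zw ss sg}.
have [z [y [s [a [b [Zu Zw ss [az wab lab dab]]]]]]] := lift k.
have sg : size (kappa z y :: pairmap kappa y s) = girth c by rewrite /= size_pairmap ss.
have [D eD] : exists D, D = a ++ (y :: s) ++ b by exists (a ++ (y :: s) ++ b).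
(* Inserting [D] costs nothing and makes the length congruent to [t.+1] modulo the girth. *)
rewrite -eD in wab lab dab; pose W := p ++ D ++ q.
have wW : wt N x (p ++ q) = wt N x W by rewrite /W !wt_cat -/c lab wab mul1r.
have lW : last x (p ++ q) = last x W by rewrite /W !last_cat -/c lab.
have sW : size W = t.+1 %[mod girth c].
  rewrite /W size_cat size_cat addnCA -size_cat st addnCA.
  by move/dvdnP: dab => [m ->]; rewrite addnC modnMDl.
have zW : kappa z y \in pairmap kappa x W.
  by rewrite /W eD !pairmap_cat -/c az /= !(mem_cat, in_cons) eqxx /= !orbT.
rewrite wW lW; case eW : W => [|w0 W']; first by rewrite eW in zW.
rewrite eW in sW zW.
apply: le_trans; first by rewrite eN; apply: (wt_lift kP').
rewrite eN factor_pow; set ks := pairmap _ _ _.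
apply: le_trans (factor_entry_le U ((L *m U) ^+ t) L x (kappa x w0) (last (kappa x w0) ks) _).
rewrite !rmax_leM //.
apply: (pow_ge_walk_through_cycle closedB gamma_gt0 clBP Zu Zw).
- by apply/hasP; exists (kappa z y) => //; exact: mem_head.
- rewrite sg /ks size_pairmap; apply/eqP; rewrite -(eqn_modDr 1) !addn1 eq_sym.
  by apply/eqP.
- by rewrite sg.
Qed.

End Transient.

(** * The transient *)

Section TransientBounds.
Variables (R : realType) (d r : nat) (A : 'M[Rmax R]_d).
Hypothesis lam_neq0 : max_cycle_mean A != 0.
Hypothesis A_factorizes : factorizes A r.
Variables (gamma : nat) (cl : 'I_d -> nat).
Hypothesis gamma_gt0 : (0 < gamma)%N.
Hypothesis cl_arc : forall x y, arc A x y -> cl y = (cl x).+1 %[mod gamma].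

Lemma weak_csr_from_critical T :
  (forall x t, critical_node A x -> (T <= t.+1)%N ->
     let g := girth_in (critical_arc A) (scc (critical_arc A) x) in
     (g * (r %/ gamma) + r <= t + 2 * g)%N \/
     (gamma * Wi (r %/ gamma) + r %% gamma <= t)%N) ->
  (0 < T)%N -> weak_csr_from A T.
Proof.
move=> H T0; apply: weak_csr_from_le => // -[|t] x y Tt.
  by rewrite leqn0 in Tt; rewrite (eqP Tt) in T0.
apply: csr_le => // p q pc <- [k sk].
have [_ _ W] := pow_ge_critical_walk lam_neq0 A_factorizes gamma_gt0 cl_arc q pc.
exact: W sk (H _ _ pc Tt).
Qed.

Lemma weak_csr_from_Wi :
  weak_csr_from A (gamma * Wi (r %/ gamma) + r %% gamma + 1).
Proof.
apply: weak_csr_from_critical => [x t _|]; last by rewrite addn1.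
by rewrite addn1 ltnS; right.
Qed.

Lemma girth_dvdn_le x : critical_node A x ->
  let g := girth_in (critical_arc A) (scc (critical_arc A) x) in
  (gamma %| g)%N /\ (0 < g <= r)%N.
Proof.
move=> xc g.
have [gd gr _] := pow_ge_critical_walk lam_neq0 A_factorizes gamma_gt0 cl_arc (p := [::]) [::] xc.
split; first exact: gd.
apply/andP; split; last exact: gr.
have /existsP[[c /= sc] /andP[/andP[c0 _] _]] := girth_cycle lam_neq0 xc.
by rewrite /g -(eqP sc); case: (c) c0.
Qed.

(** If [r %/ gamma] is at least 2, the bound is nondecreasing in the girth. If it is 1, every girth
    is a multiple of [gamma] below [2 * gamma], so all equal [gamma]. It is not 0, as [gamma]
    divides a girth that is at most [r]. *)
Lemma weak_csr_from_girth : exists2 T, weak_csr_from A T &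
  T%:Z = (max_critical_girth A)%:Z * ((r %/ gamma)%N%:Z - 2) + r%:Z + 1.
Proof.
have [x0 x0c eg] := max_critical_girth_attained lam_neq0.
have [gd /andP[g0 gr]] := girth_dvdn_le x0c; rewrite -eg in gd g0 gr.
set g := max_critical_girth A in eg gd g0 gr *.
set q := (r %/ gamma)%N.
have q0 : (0 < q)%N by rewrite divn_gt0 // (leq_trans (dvdn_leq g0 gd) gr).
have T0 : (2 * g < g * q + r + 1)%N.
  have : (g <= g * q)%N by rewrite -{1}[g]muln1 leq_mul2l q0 orbT.
  by move: gr; clear; lia.
exists (g * q + r + 1 - 2 * g)%N; last first.
  by rewrite -subzn ?(ltnW T0) // !PoszD !PoszM mulrBr; lia.
apply: weak_csr_from_critical; last by rewrite subn_gt0.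
move=> x t xc Tt; left; set gx := girth_in _ _.
have [gxd /andP[gx0 gxr]] := girth_dvdn_le xc; rewrite -/gx in gxd gx0 gxr.
have gxg : (gx <= g)%N by apply: girth_le_max.
rewrite -/q; have [q2|q1] := leqP 2 q.
  have : (gx * (q - 2) <= g * (q - 2))%N by rewrite leq_mul2r gxg orbT.
  have e k : (k * q = k * (q - 2) + 2 * k)%N by rewrite [(2 * k)%N]mulnC -mulnDr subnK.
  by move: Tt; rewrite !e; clear; lia.
have eq1 : q = 1%N by apply/eqP; rewrite eqn_leq q0 -ltnS q1.
have small k : (gamma %| k)%N -> (0 < k)%N -> (k <= r)%N -> k = gamma.
  move=> /dvdnP[m ->]; rewrite muln_gt0 => /andP[m0 _] kr.
  have : (m <= q)%N by rewrite leq_divRL.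
  by rewrite eq1; case: m m0 {kr} => [|[|]] // _ _; rewrite mul1n.
move: Tt; rewrite eq1 !muln1 (small gx) // (small g) //; clear; lia.
Qed.

End TransientBounds.

(** * Irreducible matrices and their cyclic classes *)

Section Irreducible.
Variables (R : realType) (d : nat) (A : 'M[Rmax R]_d).
Hypothesis d_gt0 : (0 < d)%N.

(** [graph_cyclicity] only involves cycles without repetition; a closed walk is cut into such cycles
    at its repeated nodes. *)
Lemma closed_walk_dvdn x p : path (arc A) x p -> last x p = x ->
  (graph_cyclicity A %| size p)%N.
Proof.
have [m] := ubnP (size p); elim: m p x => // m IH p x; rewrite ltnS.
case/lastP: p => [|p z]; first by rewrite dvdn0.
rewrite last_rcons size_rcons => pm + ez; rewrite {z}ez => pp.
have [up|] := boolP (uniq (x :: p)).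
  have -> : (size p).+1 = size (x :: p) by [].
  apply: cyclicity_dvdn; apply/existsP; exists (in_tuple (x :: p)).
  apply/andP; split; last by apply/allP => y _; rewrite inE.
  by rewrite /is_cycle /ucycleb; apply/andP; split=> //; apply/andP.
case/not_uniq_ex => y [k e].
have [p0 [[|l ls] [s [ep p0y lls sls]]]] := split_loops e; first by [].
move: lls => /= /andP[/andP[l0 /eqP ly] lls].
have l_gt0 : (0 < size l)%N by rewrite lt0n size_eq0.
have sl : (size l + size (splice p0 ls s) = size p)%N.
  by rewrite ep /splice /= !size_cat; lia.
have /and3P[q1 q2 q3] : [&& path (arc A) x p0, path (arc A) y l
    & path (arc A) y (flatten ls ++ s ++ [:: x])].
  by move: pp; rewrite ep -!cats1 /= -!catA cat_path p0y cat_path ly.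
rewrite -sl -addnS dvdn_add //.
  by apply: (IH _ y) => //; apply: leq_trans pm; rewrite -sl ltnS leq_addr.
rewrite -(size_rcons _ x); apply: (IH _ x); rewrite ?last_rcons //.
  by rewrite size_rcons; apply: leq_ltn_trans pm; rewrite -sl -addn1 addnC leq_add2r.
by rewrite -cats1 /splice -!catA cat_path p0y q1.
Qed.

Hypothesis A_irreducible : irreducible A.

Lemma irreducible_connect x y : connect (arc A) x y.
Proof. by have [/forallP/(_ x)/forallP/(_ y)] := A_irreducible. Qed.

Lemma irreducible_cycle : exists c, is_cycle (arc A) c.
Proof.
have [x [y xy]] : exists x y, arc A x y.
  (* In dimension 1 only the excluded matrix has no arc; in higher dimension two distinct nodes are
     connected. *)
  have [_ nz] := A_irreducible; have [d1|d1] := eqVneq d 1%N.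
    apply: contrapT => H; apply: nz; split=> // x y; apply/eqP/negPn/negP => n0.
    by apply: H; exists x, y.
  have d2 : (1 < d)%N by rewrite ltn_neqAle eq_sym d1.
  have /connectP[[|y p] /= ] := irreducible_connect (Ordinal d_gt0) (Ordinal d2).
    by move=> _ /(congr1 val).
  by move=> /andP[xy _] _; exists (Ordinal d_gt0), y.
have /connectP[p pp ex] := irreducible_connect y x.
case/shortenP: pp ex => q pq uq _ ex; exists (y :: q).
rewrite /is_cycle /ucycleb; apply/andP; split=> //; apply/andP; split=> //.
by rewrite /cycle rcons_path pq -ex.
Qed.

Lemma irreducible_max_cycle_mean : max_cycle_mean A != 0.
Proof.
have [c cc] := irreducible_cycle; apply: rmax_le_neq0 (cycle_mean_le cc) _.
case: c cc => [|x p]; first by case/andP.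
rewrite is_cycleE => /andP[up w0]; rewrite /cycle_mean cycle_weight //.
by case: (wt A x _) w0.
Qed.

Lemma graph_cyclicity_gt0 : (0 < graph_cyclicity A)%N.
Proof.
have [c cc] := irreducible_cycle.
have kc : cycle_length_in (arc A) [set: 'I_d] (size c).
  apply/existsP; exists (in_tuple c); rewrite cc /=.
  by apply/allP => y _; rewrite inE.
apply: dvdn_gt0 (cyclicity_dvdn kc).
by case/andP: cc; rewrite -size_eq0 lt0n.
Qed.

(** The class of a node is the length of a walk from [x0] to it. A common way back closes both the
    walk to [y] and the one through [x], so their lengths agree modulo the cyclicity. *)
Lemma irreducible_class : exists cl : 'I_d -> nat,
  forall x y, arc A x y -> cl y = (cl x).+1 %[mod graph_cyclicity A].
Proof.
pose x0 := Ordinal d_gt0.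
have [|cl clP] := @choice _ _ (fun y k => exists p, [/\ path (arc A) x0 p, last x0 p = y & size p = k]).
  by move=> y; have /connectP[p pp ey] := irreducible_connect x0 y; exists (size p), p.
exists cl => x y xy; have [p [pp px ps]] := clP x; have [q [pq qy qs]] := clP y.
have /connectP[s ps' es] := irreducible_connect y x0.
have d1 : (graph_cyclicity A %| cl y + size s)%N.
  rewrite -qs -size_cat; apply: (@closed_walk_dvdn x0); last by rewrite last_cat qy.
  by rewrite cat_path pq qy.
have d2 : (graph_cyclicity A %| (cl x).+1 + size s)%N.
  rewrite -ps addSnnS -[(size s).+1]/(size (y :: s)) -size_cat.
  apply: (@closed_walk_dvdn x0); last by rewrite last_cat px /= -es.
  by rewrite cat_path pp px /= xy.
by apply/eqP; rewrite -(eqn_modDr (size s)) (eqP d1) (eqP d2).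
Qed.

End Irreducible.

(** * The least transient and its four bounds *)

Lemma is_T1N_ex (R : realType) d (A : 'M[Rmax R]_d) T :
  weak_csr_from A T -> exists T1, is_T1N A T1.
Proof.
move=> wT; have exT : exists T, `[< weak_csr_from A T >] by exists T; apply/asboolP.
have [T1 /asboolP w1 min1] := ex_minnP exT; exists T1; split=> // T' /asboolP.
exact: min1.
Qed.

Theorem theorem3p4 (R : realType) (d : nat) (d_gt0 : (0 < d)%N)
    (A : 'M[Rmax R]_d) :
  let r := factor_rank A in
  let gamma := graph_cyclicity A in
  let g := max_critical_girth A in
  (irreducible A ->
   exists T : nat,
     [/\ is_T1N A T,
         (T <= Wi r + 1)%N,
         T%:Z <= g%:Z * (r%:Z - 2) + r%:Z + 1,
         (T <= gamma * Wi (r %/ gamma) + r %% gamma + 1)%N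
       & T%:Z <= g%:Z * ((r %/ gamma)%N%:Z - 2) + r%:Z + 1]) /\
  (reducible A -> max_cycle_mean A <> 0 ->
   exists T : nat,
     [/\ is_T1N A T,
         (T <= Wi r + 1)%N
       & T%:Z <= g%:Z * (r%:Z - 2) + r%:Z + 1]).
Proof.
move=> r gamma g; have A_r : factorizes A r.
  by rewrite /r /factor_rank; case: ex_minnP => k /asboolP.
have general : max_cycle_mean A != 0 -> exists T, [/\ is_T1N A T,
    (T <= Wi r + 1)%N & T%:Z <= g%:Z * (r%:Z - 2) + r%:Z + 1].
  move=> lam_neq0.
  (* With [gamma = 1] the constant class function qualifies for every matrix, whence the first two
     bounds without irreducibility. *)
  have cl0 (x y : 'I_d) : arc A x y -> 0%N = 1%N %[mod 1] by rewrite !modn1.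
  have := weak_csr_from_Wi lam_neq0 A_r (ltn0Sn 0) cl0.
  rewrite divn1 modn1 mul1n addn0 => w1.
  have [T2 w2 e2] := weak_csr_from_girth lam_neq0 A_r (ltn0Sn 0) cl0.
  have [T [wT minT]] := is_T1N_ex w1; exists T; split=> //; first exact: minT.
  by rewrite divn1 in e2; rewrite -e2 lez_nat minT.
split=> [irr|_ /eqP]; last exact: general.
have lam_neq0 := irreducible_max_cycle_mean d_gt0 irr.
have gamma_gt0 := graph_cyclicity_gt0 d_gt0 irr.
have [cl clP] := irreducible_class d_gt0 irr.
have [T [[wT minT] b1 b2]] := general lam_neq0; exists T; split=> //.
  exact/minT/(weak_csr_from_Wi lam_neq0 A_r gamma_gt0 clP).
have [T2 w2 e2] := weak_csr_from_girth lam_neq0 A_r gamma_gt0 clP.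
by rewrite -e2 lez_nat minT.
Qed.
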